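(* Let $G$ be a commutative topological group. The following assertions hold. (i) Two minimal topological dynamical systems $(K_1,\varphi_1)$ and $(K_2,\varphi_2)$ (with acting group $G$) with discrete spectrum are isomorphic if and only if $\sigma_{\mathrm{p}}(K_1,\varphi_1)=\sigma_{\mathrm{p}}(K_2,\varphi_2)$. (ii) For every subgroup $\sigma\subset G^*$ there is a minimal topological dynamical system $(K,\varphi)$ with discrete spectrum such that $\sigma_{\mathrm{p}}(K,\varphi)=\sigma$. (iii) For every minimal topological dynamical system $(K,\varphi)$ with discrete spectrum there is a group compactification $(H,c)$ of $G$ such that $(K,\varphi)$ is isomorphic to the rotation $(H,\varphi_c)$.
   Context: Compact spaces are Hausdorff and non-empty; vector spaces are complex. $\mathbb{T}$ is the complex unit circle and $G^*$ is the group of continuous group homomorphisms $\chi\colon G\to\mathbb{T}$ (with pointwise multiplication). A topological dynamical system $(K,\varphi)$ is a compact space $K$ with a continuous action $\varphi\colon G\times K\to K$, $(t,x)\mapsto\varphi_t(x)$. It is minimal if $K$ and $\emptyset$ are the only closed invariant subsets. Two systems $(K,\varphi)$, $(L,\psi)$ are isomorphic if there is a homeomorphism $q\colon K\to L$ with $q\circ\varphi_t=\psi_t\circ q$ for all $t\in G$. The Koopman representation is $T^\varphi\colon G\to\mathscr{L}(\mathrm{C}(K))$, $T^\varphi_tf=f\circ\varphi_{t^{-1}}$. The system has discrete spectrum if the union of all finite-dimensional $T^\varphi$-invariant subspaces of $\mathrm{C}(K)$ is dense in $\mathrm{C}(K)$. Its point spectrum is $$\sigma_{\mathrm{p}}(K,\varphi)=\{\chi\in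 G^*\mid \exists f\in\mathrm{C}(K)\setminus\{0\}\text{ with }T^\varphi_tf=\chi(t)f\text{ for every }t\in G\}.$$ A group compactification of $G$ is a pair $(H,c)$ of a compact group $H$ and a continuous group homomorphism $c\colon G\to H$ with dense range ($c$ need not be injective). The associated rotation is the system $(H,\varphi_c)$ with $(\varphi_c)_t(x)=c(t)x$. *)

(* Defs.v *)
From HB Require Import structures.
From mathcomp Require Import all_boot all_order all_algebra.
From mathcomp Require Import all_classical all_reals all_analysis.
From mathcomp Require Import complex.

Set Implicit Arguments.
Unset Strict Implicit.
Unset Printing Implicit Defensive.

Import Order.TTheory GRing.Theory Num.Theory.
Import numFieldNormedType.Exports.

Local Open Scope classical_set_scope.
Local Open Scope ring_scope.

(* The topological structure that MathComp-Analysis puts on numeric fields is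
   attached to [numClosedFieldType], not to the bare type [R[i]]: naming the
   structure lets topological notions be inferred on complex-valued maps. *)
Definition Cplx (R : realType) : numClosedFieldType := R[i].

(* Not necessarily commutative, not necessarily Hausdorff. *)
HB.structure Definition PreTopologicalGroup := {G of Topological G & Group G}.

HB.mixin Record PreTopologicalGroup_isTopologicalGroup G
    & PreTopologicalGroup G := {
  mulg_continuous : continuous (fun p : G * G => (p.1 * p.2)%g) ;
  invg_continuous : continuous (fun x : G => x^-1%g)
}.

#[short(type="topologicalGroupType")]
HB.structure Definition TopologicalGroup :=
  {G of PreTopologicalGroup G & PreTopologicalGroup_isTopologicalGroup G}.

(* Compact spaces are Hausdorff and non-empty. *)
Definition compact_space (K : topologicalType) : Prop :=
  [/\ compact [set: K], hausdorff_space K & [set: K] !=set0].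

Section characters.
Context (R : realType) (G : topologicalGroupType).
Implicit Types (chi : G -> Cplx R) (sigma : set (G -> Cplx R)).

(* The circle is not packaged as a group: a character is a map into the complex
   numbers all of whose values have modulus one. *)
Definition dual_group : set (G -> Cplx R) := [set chi : G -> Cplx R |
  [/\ continuous chi, (forall t, `|chi t| = 1) &
      forall s t, chi (s * t)%g = chi s * chi t]].

Definition dual_subgroup sigma : Prop :=
  [/\ sigma `<=` dual_group,
      sigma (fun=> 1),
      (forall chi eta, sigma chi -> sigma eta ->
         sigma (fun t => chi t * eta t)) &
      forall chi, sigma chi -> sigma (fun t => (chi t)^-1)].

End characters.

Record tds (G : topologicalGroupType) := TDS {
  tds_space :> topologicalType ;
  tds_act : G -> tds_space -> tds_space ;
  tds_compact : compact_space tds_space ;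
  tds_act1 : forall x, tds_act 1%g x = x ;
  tds_actM : forall s t x, tds_act (s * t)%g x = tds_act s (tds_act t x) ;
  tds_act_continuous : continuous (fun p : G * tds_space => tds_act p.1 p.2)
}.

Section systems.
Context (R : realType) (G : topologicalGroupType).

Definition minimal (S : tds G) : Prop := forall A : set S,
  closed A -> (forall t, tds_act t @` A `<=` A) -> A = set0 \/ A = [set: S].

Definition tds_isomorphic (S1 S2 : tds G) : Prop :=
  exists q : S1 -> S2,
    [/\ continuous q,
        (exists q' : S2 -> S1, [/\ continuous q', cancel q q' & cancel q' q]) &
        forall t, q \o tds_act t = tds_act t \o q].

Context (S : tds G).
Implicit Types (f : S -> Cplx R) (M : set (S -> Cplx R)).

Definition Cspace : set (S -> Cplx R) := [set f : S -> Cplx R | continuous f].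

Definition koopman (t : G) f : S -> Cplx R := f \o tds_act t^-1%g.

Definition fd_subspace M : Prop :=
  exists (n : nat) (e : 'I_n -> S -> Cplx R),
    (forall i, Cspace (e i)) /\
    M = [set f | exists a : 'I_n -> Cplx R,
                   f = fun x => \sum_(i < n) a i * e i x].

Definition koopman_invariant M : Prop :=
  forall t f, M f -> M (koopman t f).

(* [{uniform S -> Cplx R}] carries the topology of uniform convergence, which
   on C(S) is the topology of the supremum norm. *)
Definition discrete_spectrum : Prop :=
  Cspace `<=` closure (\bigcup_(M in [set M | fd_subspace M /\
                                               koopman_invariant M]) M
                       : set {uniform S -> Cplx R}).

Definition point_spectrum : set (G -> Cplx R) := [set chi : G -> Cplx R |
  dual_group chi /\
  exists f, [/\ Cspace f, f <> (fun=> 0) &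
                forall t, koopman t f = (fun x => chi t * f x)]].

End systems.

Arguments discrete_spectrum R {G} S.
Arguments point_spectrum R {G} S.

Record group_compactification (G : topologicalGroupType) := GroupCompactification {
  gc_group :> topologicalGroupType ;
  gc_map : G -> gc_group ;
  gc_compact : compact_space gc_group ;
  gc_continuous : continuous gc_map ;
  gc_morph : {morph gc_map : s t / (s * t)%g} ;
  gc_dense : dense (range gc_map)
}.

Section rotation.
Context (G : topologicalGroupType) (H : group_compactification G).

Let act (t : G) (x : H) : H := (gc_map H t * x)%g.

Let act1 x : act 1%g x = x.
Proof.
suff -> : act 1%g x = (1 * x)%g by rewrite mul1g.
congr (_ * x)%g; apply: (@mulgI _ (gc_map H 1%g)).
by rewrite -gc_morph !mulg1.
Qed.

Let actM s t x : act (s * t)%g x = act s (act t x).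
Proof. by rewrite /act gc_morph mulgA. Qed.

Let act_continuous : continuous (fun p : G * H => act p.1 p.2).
Proof.
move=> p; apply: (@continuous_comp _ (H * H)%type _
  (fun p => (gc_map H p.1, p.2)) (fun q => (q.1 * q.2)%g)); last first.
  exact: mulg_continuous.
apply: cvg_pair => /=; last exact: cvg_snd.
by apply: continuous_comp; [exact: cvg_fst|exact: gc_continuous].
Qed.

Definition rotation : tds G := TDS (gc_compact H) act1 actM act_continuous.

End rotation.

(* Main.v *)
Require Import Defs.
From HB Require Import structures.
From mathcomp Require Import all_boot all_order all_algebra.
From mathcomp Require Import all_classical all_reals all_analysis.
From mathcomp Require Import complex ring lra.

(** Why the theorem is true.  Let S be minimal with discrete spectrum, let sigma
    be its point spectrum, and fix a base point x0.

    Eigenfunctions span a dense subspace.  A finite-dimensional invariant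
    subspace of C(S) carries commuting operators all of whose orbits are bounded.
    Boundedness excludes Jordan blocks, so these operators are simultaneously
    diagonalizable and the subspace is spanned by joint eigenfunctions, whose
    eigenvalues are characters ([fd_invariant_trig_poly]).

    Minimality rigidifies eigenfunctions.  The modulus of an eigenfunction is an
    invariant continuous function, hence constant, so for each chi in sigma there
    is exactly one eigenfunction f_chi with f_chi(x0) = 1.

    The model.  Consequently J : x |-> (f_chi(x))_chi is an injective continuous
    map from S to the product of copies of the complex plane indexed by sigma,
    which sends t.x0 to the point (chi(t^-1))_chi.  The orbit of x0 being dense,
    the image of J is the closure of these points.  That closure depends on sigma
    alone, and it is a compact group under pointwise multiplication, in which G
    has a dense image: a group compactification [char_compactification sigma].
    Thus S is isomorphic to the rotation on it ([minimal_isomorphic_rotation]),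
    which proves (iii), and (i) follows because the point spectrum is an
    isomorphism invariant.

    Realisation.  For a subgroup sigma of the dual, the coordinates of the same
    compact group are eigenfunctions with eigenvalues in sigma.  They separate
    points, and sigma is a group, so by the Stone-Weierstrass theorem they span
    a dense subspace ([rotation_discrete_spectrum]).  An eigenfunction for a
    character eta outside sigma would be uniformly approximated by combinations
    of characters different from eta; averaging over G kills those characters and
    keeps eta, a contradiction ([character_coefficient_bound]).  This is (ii). *)

Set Implicit Arguments.
Unset Strict Implicit.
Unset Printing Implicit Defensive.

Import Order.TTheory GRing.Theory Num.Theory.
Import numFieldNormedType.Exports.

Local Open Scope classical_set_scope.
Local Open Scope ring_scope.

(** * The complex plane as a topological field *)

Lemma dist_continuous (K L : numFieldType) (f : K -> L) :
  (forall x e, 0 < e ->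
     exists2 d, 0 < d & forall y, `|x - y| < d -> `|f x - f y| < e) ->
  continuous f.
Proof.
move=> fP x U /nbhs_ballP[e e0 eU]; have [d d0 fd] := fP x e e0.
by apply/nbhs_ballP; exists d => // y xy; apply: eU; exact: fd.
Qed.

Section complex_plane.
Context (R : realType).
Implicit Types (z w : Cplx R).

(** The embedding of the reals and the two coordinates, typed in [Cplx R]: that is
    where the topology of the complex plane lives, and where continuity of these
    maps can be stated. *)
Definition toC (x : R) : Cplx R := Complex x 0.
Definition reC z : R := complex.Re z.
Definition imC z : R := complex.Im z.

(** Norms on [Cplx R] take complex values. Extracting a real witness moves
    estimates to the totally ordered field [R]. *)
Lemma toC_norm z : {r : R | `|z| = toC r & 0 <= r}.
Proof.
exists (Num.sqrt ((reC z) ^+ 2 + (imC z) ^+ 2)); last exact: sqrtr_ge0.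
exact: normc_def.
Qed.

Lemma toC_le (x y : R) : (toC x <= toC y) = (x <= y).
Proof. exact: lecR. Qed.

Lemma toC_lt (x y : R) : (toC x < toC y) = (x < y).
Proof. exact: ltcR. Qed.

Lemma toC_continuous : continuous toC.
Proof.
apply: dist_continuous => x e e0.
have [r er r0] := toC_norm e.
have e' : e = toC r by rewrite -er gtr0_norm.
have r1 : 0 < r by rewrite -toC_lt -e'.
exists r => // y xy.
have -> : toC x - toC y = toC (x - y) by rewrite /toC -(rmorphB (real_complex R)).
by rewrite e' normc_def /= expr0n addr0 sqrtr_sqr ltcR.
Qed.

Lemma toCD (x y : R) : toC (x + y) = toC x + toC y.
Proof. exact: (rmorphD (real_complex R)). Qed.

Lemma toCB (x y : R) : toC (x - y) = toC x - toC y.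
Proof. exact: (rmorphB (real_complex R)). Qed.

Lemma toCM (x y : R) : toC (x * y) = toC x * toC y.
Proof. exact: (rmorphM (real_complex R)). Qed.

Lemma toCV (x : R) : toC x^-1 = (toC x)^-1.
Proof. exact: (fmorphV (real_complex R)). Qed.

Lemma toC_natr n : toC n%:R = n%:R.
Proof. exact: (rmorph_nat (real_complex R)). Qed.

Lemma reimE z : z = toC (reC z) + 'i * toC (imC z).
Proof. exact: complexE. Qed.

Lemma toC_reE z : toC (reC z) = (z + z^*) / 2.
Proof. exact: ReJ_add. Qed.

Lemma toC_imE z : toC (imC z) = (z^* - z) / 2 * 'i.
Proof. exact: ImJ_sub. Qed.

Lemma conjC_continuous : continuous (fun z : Cplx R => z^*).
Proof.
apply: (@dist_continuous (Cplx R) (Cplx R)) => z e e0; exists e => // w.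
by rewrite -rmorphB norm_conjC.
Qed.

Lemma norm_toC (x : R) : `|toC x| = toC `|x|.
Proof. by rewrite normc_def /= expr0n addr0 sqrtr_sqr. Qed.

Lemma re_le_norm z : toC `|reC z| <= `|z|.
Proof.
rewrite normc_def toC_le -sqrtr_sqr; apply: ler_wsqrtr.
by rewrite lerDl sqr_ge0.
Qed.

Lemma im_le_norm z : toC `|imC z| <= `|z|.
Proof.
rewrite normc_def toC_le -sqrtr_sqr; apply: ler_wsqrtr.
by rewrite lerDr sqr_ge0.
Qed.

Lemma reC_continuous : continuous reC.
Proof.
apply: (@dist_continuous (Cplx R) R) => z e e0; exists (toC e).
  by rewrite -[0]/(toC 0) toC_lt.
move=> w zw.
rewrite -toC_lt; have -> : reC z - reC w = reC (z - w) by case: (z) (w) => ? ? [].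
exact: (le_lt_trans (re_le_norm _)).
Qed.

Lemma imC_continuous : continuous imC.
Proof.
apply: (@dist_continuous (Cplx R) R) => z e e0; exists (toC e).
  by rewrite -[0]/(toC 0) toC_lt.
move=> w zw.
rewrite -toC_lt; have -> : imC z - imC w = imC (z - w) by case: (z) (w) => ? ? [].
exact: (le_lt_trans (im_le_norm _)).
Qed.

Lemma Cplx_hausdorff : hausdorff_space (Cplx R).
Proof. exact: (@norm_hausdorff _ (Cplx R)). Qed.

Lemma Cplx_norm_continuous : continuous (fun z : Cplx R => `|z|).
Proof. exact: (@norm_continuous _ (Cplx R)). Qed.

Lemma Cplx_mul_continuous (Z : topologicalType) (f g : Z -> Cplx R) :
  continuous f -> continuous g -> continuous (fun x => f x * g x).
Proof. by move=> fc gc x; apply: cvgM; [exact: fc|exact: gc]. Qed.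

(** The circle is closed in the image of the compact square [-1,1]^2 under the
    continuous map (a, b) |-> a + ib. *)
Lemma circle_compact : compact [set z : Cplx R | `|z| = 1].
Proof.
have cI := @segment_compact R (-1) 1.
pose g (p : R * R) : Cplx R := toC p.1 + 'i * toC p.2.
have gc : continuous g.
  move=> p; apply: cvgD.
    by apply: continuous_comp; [exact: cvg_fst|exact: toC_continuous].
  apply: cvgM; first exact: cvg_cst.
  by apply: continuous_comp; [exact: cvg_snd|exact: toC_continuous].
have cgI := continuous_compact (continuous_subspaceT gc) (compact_setX cI cI).
apply: (subclosed_compact _ cgI); last first.
  move=> z /= z1; exists (reC z, imC z); last by rewrite /g /= -reimE.
  split; rewrite /= in_itv /= -ler_norml -toC_le.
    by rewrite (le_trans (re_le_norm _)) // z1.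
  by rewrite (le_trans (im_le_norm _)) // z1.
apply: (@preimage_closed _ _ (fun z : Cplx R => `|z|) [set 1]).
  by move=> z _; exact: Cplx_norm_continuous.
exact/accessible_closed_set1/hausdorff_accessible/Cplx_hausdorff.
Qed.

Lemma continuous_bounded (S : topologicalType) (f : S -> Cplx R) :
  compact [set: S] -> continuous f -> exists B : R, forall x, `|f x| <= toC B.
Proof.
move=> cS cf.
pose n x := let: exist2 r _ _ := toC_norm (f x) in r.
have nE x : `|f x| = toC (n x) by rewrite /n; case: toC_norm.
have [[x0 _]|S0] := pselect ([set: S] !=set0); last first.
  by exists 0 => x; case: S0; exists x.
have [] := @compact_EVT_max S R n setT _ cS.
- by exists x0.
- apply: continuous_subspaceT.
  have -> : n = (fun x => reC `|f x|) by apply/funext => x; rewrite nE.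
  move=> x; apply: continuous_comp; last exact: reC_continuous.
  by apply: continuous_comp; [exact: cf|exact: Cplx_norm_continuous].
move=> x _ hx; exists (n x) => y; rewrite nE toC_le; apply: hx.
by rewrite inE.
Qed.

Lemma toC_archi (x : R) : exists n : nat, toC x < n%:R.
Proof.
exists (Num.truncn `|x|).+1; rewrite -toC_natr toC_lt.
by rewrite (le_lt_trans (ler_norm _)) // truncnS_gt.
Qed.

End complex_plane.

(** * Compactness and the Stone-Weierstrass theorem *)

(** The covering characterisation of compactness on a space without a chosen base
    point, with the finite subcover given as a list. *)
Lemma compact_finite_cover (T : topologicalType) (A : set T) (I : choiceType)
    (U : I -> set T) :
  compact A -> (forall i, open (U i)) -> (forall x, A x -> exists i, U i x) ->
  exists s : seq I, forall x, A x -> exists2 i, i \in s & U i x.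
Proof.
move=> /compact_near_coveringP cA oU coverU.
(* the filter generated by the sets of all lists extending a given list *)
pose F : set_system (seq I) :=
  [set P | exists s0 : seq I, forall s : seq I, {subset s0 <= s} -> P s].
have FF : Filter F.
  split; first by exists [::].
    move=> P Q [s1 P1] [s2 P2]; exists (s1 ++ s2) => s ss; split.
      by apply: P1 => i i1; apply: ss; rewrite mem_cat i1.
    by apply: P2 => i i2; apply: ss; rewrite mem_cat i2 orbT.
  by move=> P Q PQ [s0 P0]; exists s0 => s /P0 /PQ.
have [|s0 s0P] := cA _ F (fun s x => exists2 i, i \in s & U i x) FF.
  move=> x /coverU [i Ux]; exists (U i, [set s : seq I | i \in s]) => /=.
    split; first exact: open_nbhs_nbhs.
    by exists [:: i] => s; apply; rewrite mem_head.
  by move=> [y s] /= [Uy iS]; exists i.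
by exists s0; apply: s0P.
Qed.

Lemma expr_small (R : realType) (x K e : R) :
  0 <= x < 1 -> 0 < e -> exists n, K * x ^+ n < e.
Proof.
move=> /andP[x0 x1] e0.
have xK : (fun n => K * x ^+ n) @ \oo --> K * 0.
  by apply: cvgM; [exact: cvg_cst|apply: cvg_expr; rewrite ger0_norm].
rewrite mulr0 in xK.
have [n _ /(_ n (leqnn n))] := cvgr0_norm_lt _ xK _ e0.
by move=> /= h; exists n; rewrite (le_lt_trans (ler_norm _)).
Qed.

(** Urysohn's lemma applied to two points. *)
Lemma continuous_separates (R : realType) (T : topologicalType) (x y : T) :
  compact [set: T] -> hausdorff_space T ->
  (forall f : T -> Cplx R, continuous f -> f x = f y) -> x = y.
Proof.
move=> cT hT fxy; apply: contrapT => xy.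
have normT := compact_normal hT cT.
have clP z : closed [set z : T].
  exact/accessible_closed_set1/hausdorff_accessible.
have /(@uniform_separatorP _ R)[h [hc _ hx hy]] : uniform_separator [set x] [set y].
  apply: (@normal_separatorP R T).1 => //.
  by apply/seteqP; split=> // z [/= -> yx]; exact: xy.
have hCc : continuous (fun z => toC (h z)).
  move=> z; apply: (@continuous_comp _ _ _ h (@toC R)); first exact: hc.
  exact: toC_continuous.
have hx0 : h x = 0 by apply: hx; exists x.
have hy1 : h y = 1 by apply: hy; exists y.
by have := fxy _ hCc; rewrite hx0 hy1 => /eqP; rewrite eq_complex /= eq_sym oner_eq0.
Qed.

Section stone_weierstrass.
Context (R : realType) (S : topologicalType) (A : set (S -> R)).
Context (cS : compact [set: S]).
Context (A_continuous : forall g, A g -> continuous g).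
Context (A_cst : forall c, A (fun=> c)).
Context (AD : forall g h, A g -> A h -> A (fun x => g x + h x)).
Context (AM : forall g h, A g -> A h -> A (fun x => g x * h x)).
Context (A_separates : forall x y, x != y -> exists2 g, A g & g x != g y).

Let A_sum (I : Type) (s : seq I) (F : I -> S -> R) :
  (forall i, A (F i)) -> A (fun x => \sum_(i <- s) F i x).
Proof.
move=> AF; elim: s => [|i s IH].
  by under [X in A X]eq_fun do rewrite big_nil; exact: A_cst.
by under [X in A X]eq_fun do rewrite big_cons; exact: AD.
Qed.

Let A_exp g n : A g -> A (fun x => g x ^+ n).
Proof.
move=> Ag; elim: n => [|n IH].
  by under [X in A X]eq_fun do rewrite expr0; exact: A_cst.
by under [X in A X]eq_fun do rewrite exprS; exact: AM.
Qed.

(** Finitely many functions g of A separate all pairs of the compact set E, so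
    d(x,y) = sum of (g x - g y)^2 is bounded below by a positive constant on E;
    the kernel is 1 - d/M with M an upper bound of d.  The rate r is the same for
    all pairs, which is what makes the kernel usable without a group structure. *)
Let separating_kernel (E : set (S * S)) :
  closed E -> (forall x, ~ E (x, x)) ->
  exists (k : S -> S -> R) (r : R),
    [/\ 0 < r <= 1,
        (forall y, A (k^~ y)) ,
        (forall x y, 0 <= k x y <= 1), (forall x, k x x = 1) &
        forall x y, E (x, y) -> k x y <= 1 - r].
Proof.
move=> clE Ediag.
pose I := {g : S -> R | A g}.
have cE : compact E.
  apply: (subclosed_compact clE (compact_setX cS cS)) => //.
have g_cts (g : S -> R) : A g -> continuous (fun p : S * S => g p.1 - g p.2).
  move=> /A_continuous gc p; apply: cvgB.
    by apply: continuous_comp; [exact: cvg_fst|exact: gc].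
  by apply: continuous_comp; [exact: cvg_snd|exact: gc].
pose U (i : {classic I}) := [set p : S * S | sval i p.1 - sval i p.2 != 0].
have [s sP] : exists s : seq {classic I},
    forall p, E p -> exists2 i, i \in s & U i p.
  apply: compact_finite_cover => //.
    case=> g Ag; rewrite /U /=.
    rewrite (_ : [set _ | _] = (fun p : S * S => g p.1 - g p.2) @^-1` [set~ 0]).
      apply: open_comp; first by move=> p _; exact: g_cts.
      exact/closed_openC/accessible_closed_set1/hausdorff_accessible/Rhausdorff.
    by apply/seteqP; split=> p /= /eqP.
  move=> [x y] Exy; have [|g Ag gxy] := @A_separates x y.
    by apply: contra_not_neq (Ediag x); move: Exy => /[swap] ->.
  by exists (exist _ g Ag); rewrite /U /= subr_eq0.
pose d x y := \sum_(i <- s) (sval i x - sval i y) ^+ 2.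
have d_ge0 x y : 0 <= d x y by apply: sumr_ge0 => i _; exact: sqr_ge0.
have dxx x : d x x = 0 by rewrite /d big1 // => i _; rewrite subrr expr0n.
have d_gt0 x y : E (x, y) -> 0 < d x y.
  move=> /sP[i si Ui]; rewrite /d (big_rem i) //= ltr_pwDl //.
    by rewrite lt_def sqr_ge0 sqrf_eq0 andbT.
  by apply: sumr_ge0 => j _; exact: sqr_ge0.
have d_cts : continuous (fun p : S * S => d p.1 p.2).
  rewrite /d; elim: (s) => [|i s' IH].
    by under [X in continuous X]eq_fun do rewrite big_nil; exact: cst_continuous.
  under [X in continuous X]eq_fun do rewrite big_cons.
  move=> p; apply: cvgD; last exact: IH.
  by under eq_fun do rewrite expr2; apply: cvgM; apply: g_cts (svalP i) p.
have [M M0 dM] : exists2 M, 0 < M & forall x y, d x y <= M.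
  have [[x0 _]|S0] := pselect ([set: S] !=set0); last first.
    by exists 1 => // x; case: S0; exists x.
  have SS0 : [set: S] `*` [set: S] !=set0 by exists (x0, x0).
  have [p _ pmax] := compact_EVT_max SS0 (compact_setX cS cS)
    (continuous_subspaceT d_cts).
  exists (1 + d p.1 p.2); first by rewrite ltr_pwDl.
  move=> x y; rewrite (le_trans (pmax (x, y) _)) ?inE //.
  by rewrite lerDr.
have [c c0 Ec] : exists2 c, 0 < c & forall x y, E (x, y) -> c <= d x y.
  have [E0|E0] := pselect (E !=set0); last first.
    by exists 1 => // x y Exy; case: E0; exists (x, y).
  have [p Ep pmin] := compact_EVT_min E0 cE (continuous_subspaceT d_cts).
  exists (d p.1 p.2); first by apply: d_gt0; rewrite -surjective_pairing -inE.
  by move=> x y Exy; apply: (pmin (x, y)); rewrite inE.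
exists (fun x y => 1 - d x y / M), (Num.min 1 (c / M)); split.
- by rewrite lt_min ltr01 divr_gt0 //= ge_min lexx.
- move=> y; rewrite /d.
  under [X in A X]eq_fun do rewrite mulrC -mulNr mulr_sumr.
  apply: AD => //; apply: A_sum => i; apply: AM => //.
  by under [X in A X]eq_fun do rewrite expr2; apply: AM; apply: AD => //;
    exact: svalP i.
- move=> x y; rewrite subr_ge0 ler_pdivrMr // mul1r dM /=.
  by rewrite gerBl divr_ge0 // ltW.
- by move=> x; rewrite dxx mul0r subr0.
- move=> x y /Ec cd; rewrite lerB // ge_min; apply/orP; right.
  by rewrite ler_pM2r ?invr_gt0.
Qed.

(** Kernel smoothing: a large power of the separating kernel k concentrates near
    the diagonal, so f(x) is close to the weighted mean
      (sum of f(y) k(x,y)^n) / (sum of k(x,y)^n)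
    over a finite set of centres y.  The numerator and the denominator belong to
    A, and the denominator u is bounded below by a positive constant, so 1/u is a
    uniform limit of partial sums of a geometric series in 1 - u/M. *)
Theorem real_stone_weierstrass (f : S -> R) (e : R) :
  continuous f -> 0 < e -> exists2 g, A g & forall x, `|f x - g x| < e.
Proof.
move=> fc e0.
have [B B0 fB] : exists2 B, 0 < B & forall x, `|f x| <= B.
  have [S0|S0] := pselect ([set: S] !=set0); last first.
    by exists 1 => // x; case: S0; exists x.
  have nfc : continuous (fun x => `|f x|).
    by move=> x; apply: (@continuous_comp _ _ _ f (fun z : R => `|z|) x (fc x));
      exact: (@norm_continuous _ R^o).
  have [x0 _ xmax] := compact_EVT_max S0 cS (continuous_subspaceT nfc).
  exists (1 + `|f x0|); first by rewrite ltr_pwDl.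
  by move=> x; rewrite (le_trans (xmax x _)) ?inE // lerDr.
(* the pairs on which smoothing must put little weight *)
pose E := [set p : S * S | e / 2 <= `|f p.1 - f p.2|].
have clE : closed E.
  apply: (@preimage_closed _ _ (fun p : S * S => `|f p.1 - f p.2|)
     [set y | e / 2 <= y]); last exact: (@closed_ge R (e / 2)).
  move=> p _; apply: (@continuous_comp _ _ _ (fun p : S * S => f p.1 - f p.2)
    (fun z : R => `|z|)); last exact: (@norm_continuous _ R^o).
  apply: cvgB.
    by apply: continuous_comp; [exact: cvg_fst|exact: fc].
  by apply: continuous_comp; [exact: cvg_snd|exact: fc].
have Ediag x : ~ E (x, x).
  by rewrite /E /= subrr normr0; apply/negP; rewrite -ltNge divr_gt0.
have [k [r [/andP[r0 r1] Ak k01 kxx kE]]] := separating_kernel clE Ediag.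
have [s sP] : exists s : seq S,
    forall x, [set: S] x -> exists2 y, y \in s & [set x | 1 - r / 2 < k x y] x.
  apply: compact_finite_cover => //.
    move=> y; rewrite (_ : [set _ | _] = (k^~ y) @^-1` [set z | 1 - r / 2 < z]) //.
    apply: (@open_comp _ _ (k^~ y)); last exact: open_gt.
    by move=> x _; exact: A_continuous.
  by move=> x _; exists x => /=; rewrite kxx ltrBlDr ltrDl divr_gt0.
pose m : R := (size s)%:R.
(* k <= 1 - r on E, whereas every x has a centre with k > 1 - r / 2: raised to a
   large power n, the first quantity is negligible against the second *)
have [n Hn] : exists n, 2 * B * m * (1 - r) ^+ n < e / 4 * (1 - r / 2) ^+ n.
  have c0 : 0 < 1 - r / 2 by lra.
  have [||n Hn] := @expr_small R ((1 - r) / (1 - r / 2)) (2 * B * m) (e / 4).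
  - apply/andP; split; first by apply: divr_ge0; lra.
    by rewrite ltr_pdivrMr //; lra.
  - by rewrite divr_gt0.
  by exists n; move: Hn; rewrite expr_div_n mulrA ltr_pdivrMr ?exprn_gt0.
pose a := (1 - r / 2) ^+ n.
have a0 : 0 < a by rewrite exprn_gt0 //; lra.
pose u x := \sum_(y <- s) k x y ^+ n.
pose F x := \sum_(y <- s) f y * k x y ^+ n.
have k0 x y : 0 <= k x y by have /andP[] := k01 x y.
have k1 x y : k x y <= 1 by have /andP[] := k01 x y.
have au x : a <= u x.
  have [//|y ys /= /ltW ky] := sP x _; rewrite /u (big_rem y) //=.
  rewrite (le_trans (_ : a <= k x y ^+ n)) //.
    by apply: lerXn2r; rewrite ?nnegrE ?k0 //; lra.
  by rewrite lerDl sumr_ge0 // => z _; rewrite exprn_ge0.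
have u0 x : 0 < u x by exact: lt_le_trans (au x).
have um x : u x <= m.
  rewrite /u /m -(sum1_size s) natr_sum; apply: ler_sum => y _.
  by rewrite exprn_ile1.
have fuF x : `|f x * u x - F x| <= 3 / 4 * e * u x.
  rewrite /u /F mulr_sumr -sumrB.
  apply: (le_trans (ler_norm_sum _ _ _)).
  apply: (@le_trans _ _
    (\sum_(y <- s) (e / 2 * k x y ^+ n + 2 * B * (1 - r) ^+ n))).
    apply: ler_sum => y _; rewrite -mulrBl normrM (ger0_norm (exprn_ge0 _ _)) //.
    have [Exy|] := pselect (E (x, y)).
      apply: ler_wpDl; first by rewrite mulr_ge0 ?exprn_ge0 // ltW // divr_gt0.
      apply: ler_pM => //; first by rewrite exprn_ge0.
        rewrite (le_trans (ler_normB _ _)) // mulrDl mul1r lerD //.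
      by apply: lerXn2r; rewrite ?nnegrE ?k0 ?subr_ge0 // kE.
    rewrite /E /= => /negP; rewrite -ltNge => /ltW h.
    apply: ler_wpDr; first by rewrite !mulr_ge0 ?exprn_ge0 ?subr_ge0 // ltW.
    by rewrite ler_wpM2r // exprn_ge0.
  rewrite big_split /= -mulr_sumr -/(u x) big_const_seq count_predT iter_addr addr0.
  have := au x; move: Hn; rewrite -/a -mulr_natr -/m => ? ?; nra.
have Fu x : `|F x| <= B * u x.
  rewrite /u /F mulr_sumr (le_trans (ler_norm_sum _ _ _)) //; apply: ler_sum => y _.
  by rewrite normrM (ger0_norm (exprn_ge0 _ _)) // ler_wpM2r ?exprn_ge0.
(* geometric series for 1 / u, truncated at N; M > 0 even when s is empty *)
pose M : R := m + 1.
have M0 : 0 < M by rewrite ltr_pwDr // ler0n.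
have [||N HN] := @expr_small R (1 - a / M) B (e / 4).
- rewrite subr_ge0 ler_pdivrMr // mul1r; apply/andP; split.
    rewrite (@le_trans _ _ 1) ?lerDr ?ler0n // exprn_ile1 //; lra.
  by rewrite ltrBlDr ltrDl divr_gt0.
- by rewrite divr_gt0.
pose g x := F x * (M^-1 * \sum_(i <- iota 0 N) (1 - u x / M) ^+ i).
exists g.
  have Au : A u by apply: A_sum => y; apply: A_exp.
  apply: AM; first by apply: A_sum => y; apply: AM => //; exact: A_exp.
  apply: AM => //; apply: A_sum => i; apply: A_exp.
  under [X in A X]eq_fun do rewrite -mulNr -mulN1r.
  by apply: AD => //; apply: AM => //; apply: AM.
move=> x; have ux := u0 x.
have gu : g x * u x = F x * (1 - (1 - u x / M) ^+ N).
  rewrite /g -mulrA; congr (_ * _).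
  rewrite -[X in iota 0 X]subn0 -/(index_iota 0 N) big_mkord.
  rewrite -[RHS]opprB subrX1; set q := \sum_(i < N) _.
  by field; rewrite lt0r_neq0.
have q0 : 0 <= 1 - u x / M.
  by rewrite subr_ge0 ler_pdivrMr // mul1r (le_trans (um x)) // lerDl.
rewrite -(ltr_pM2r ux) -{1}(gtr0_norm ux) -normrM mulrBl gu.
have -> : f x * u x - F x * (1 - (1 - u x / M) ^+ N) =
  (f x * u x - F x) + F x * (1 - u x / M) ^+ N by ring.
apply: (le_lt_trans (ler_normD _ _)).
rewrite normrM (ger0_norm (exprn_ge0 _ _)) //.
have qN : (1 - u x / M) ^+ N <= (1 - a / M) ^+ N.
  apply: lerXn2r; rewrite ?nnegrE //; last first.
    by rewrite lerB // ler_pM2r ?invr_gt0.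
  by rewrite (le_trans q0) // lerB // ler_pM2r ?invr_gt0.
have := fuF x; have : `|F x| * (1 - u x / M) ^+ N <= B * u x * (1 - a / M) ^+ N.
  by apply: ler_pM => //; rewrite exprn_ge0.
move: HN; nra.
Qed.

End stone_weierstrass.

(** The real-valued members of A are an algebra that still separates points,
    because A contains the real and imaginary parts of its members; the real and
    imaginary parts of f are approximated separately. *)
Theorem complex_stone_weierstrass (R : realType) (S : topologicalType)
    (A : set (S -> Cplx R)) :
  compact [set: S] ->
  (forall g, A g -> continuous g) ->
  (forall c, A (fun=> c)) ->
  (forall g h, A g -> A h -> A (fun x => g x + h x)) ->
  (forall g h, A g -> A h -> A (fun x => g x * h x)) ->
  (forall g, A g -> A (fun x => (g x)^*)) ->
  (forall x y, x != y -> exists2 g, A g & g x != g y) ->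
  forall (f : S -> Cplx R) (e : R), continuous f -> 0 < e ->
    exists2 g, A g & forall x, `|f x - g x| < toC e.
Proof.
move=> cS Ac A_cst AD AM AJ Asep f e fc e0.
pose AR := [set g : S -> R | A (fun x => toC (g x))].
have ARre g : A g -> AR (fun x => reC (g x)).
  move=> Ag; rewrite /AR /=.
  under [X in A X]eq_fun do rewrite toC_reE.
  by apply: AM => //; apply: AD => //; exact: AJ.
have ARim g : A g -> AR (fun x => imC (g x)).
  move=> Ag; rewrite /AR /=.
  under [X in A X]eq_fun do rewrite toC_imE -(mulN1r (g _)).
  by apply: (AM) => //; apply: (AM) => //; apply: AD; [exact: AJ|exact: AM].
have AR_dense := @real_stone_weierstrass R S AR cS.
have {AR_dense} dense h : continuous h ->
    exists2 g, AR g & forall x, `|h x - g x| < e / 2.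
  move=> hc; apply: AR_dense; rewrite ?divr_gt0 //.
  - move=> g /Ac gc x.
    have -> : g = (fun x => reC (toC (g x))) by [].
    apply: (@continuous_comp _ _ _ (fun x => toC (g x)) (@reC R));
      [exact: gc|exact: reC_continuous].
  - by move=> c; exact: A_cst.
  - move=> g k Ag Ak; rewrite /AR /=.
    by under [X in A X]eq_fun do rewrite toCD; exact: AD.
  - move=> g k Ag Ak; rewrite /AR /=.
    by under [X in A X]eq_fun do rewrite toCM; exact: AM.
  - move=> x y /Asep[g Ag gxy].
    have [re_xy|re_xy] := eqVneq (reC (g x)) (reC (g y)); last first.
      by exists (fun x => reC (g x)) => //; exact: ARre.
    exists (fun x => imC (g x)); first exact: ARim.
    by apply: contra_neq gxy => im_xy; rewrite (reimE (g x)) re_xy im_xy -reimE.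
have [|g1 Ag1 fg1] := dense (fun x => reC (f x)).
  move=> x; apply: (@continuous_comp _ _ _ f (@reC R));
    [exact: fc|exact: reC_continuous].
have [|g2 Ag2 fg2] := dense (fun x => imC (f x)).
  move=> x; apply: (@continuous_comp _ _ _ f (@imC R));
    [exact: fc|exact: imC_continuous].
exists (fun x => toC (g1 x) + 'i * toC (g2 x)).
  by apply: AD => //; exact: AM.
move=> x; rewrite (reimE (f x)).
have -> : toC (reC (f x)) + 'i * toC (imC (f x)) - (toC (g1 x) + 'i * toC (g2 x))
    = toC (reC (f x) - g1 x) + 'i * toC (imC (f x) - g2 x).
  by rewrite !toCB; ring.
rewrite (le_lt_trans (ler_normD _ _)) // normrM normCi mul1r !norm_toC -toCD.
by rewrite toC_lt [e]splitr ltrD.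
Qed.

(** * Operators with bounded orbits *)

(** Otherwise f would grow geometrically along the orbit of x under phi. *)
Lemma bounded_eigenvalue_le1 (R : realType) (X : Type) (phi : X -> X)
    (f : X -> Cplx R) (z : Cplx R) (B : R) (x : X) :
  (forall y, `|f y| <= toC B) -> (forall y, f (phi y) = z * f y) ->
  f x != 0 -> `|z| <= 1.
Proof.
move=> fB fphi fx0.
have [r zr r0] := toC_norm z; have [c fc c0] := toC_norm (f x).
rewrite zr -[1]/(toC 1) toC_le leNgt; apply/negP => r1.
have c1 : 0 < c by rewrite -toC_lt -fc normr_gt0.
have bound n : r ^+ n * c <= B.
  have iterE : f (iter n phi x) = z ^+ n * f x.
    by elim: n => [|n IH]; rewrite ?mul1r //= fphi IH exprS mulrA.
  have := fB (iter n phi x).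
  by rewrite iterE normrM normrX zr fc -(rmorphXn (real_complex R)) -toCM toC_le.
have rgt0 : 0 < r by rewrite (lt_trans ltr01).
have [||n] := @expr_small R r^-1 B c.
- by rewrite invr_ge0 r0 invf_lt1.
- by [].
rewrite exprVn ltr_pdivrMr ?exprn_gt0 // => h.
by have := bound n; rewrite mulrC leNgt h.
Qed.

Section isometry_eigenvalues.
Context (R : realType) (X : Type) (phi psi : X -> X).
Implicit Types (f g : X -> Cplx R) (z : Cplx R) (B : R).

Context (psiK : cancel psi phi).

Lemma bounded_eigenvalue_norm1 f z B x :
  (forall y, `|f y| <= toC B) -> (forall y, f (phi y) = z * f y) ->
  f x != 0 -> `|z| = 1.
Proof.
move=> fB fphi fx0; apply/le_anti/andP; split.
  exact: bounded_eigenvalue_le1 fB fphi fx0.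
have z0 : z != 0.
  by apply: contra_neq fx0 => z0; rewrite -(psiK x) fphi z0 mul0r.
have fpsi y : f (psi y) = z^-1 * f y.
  by rewrite -{2}(psiK y) fphi mulKf.
have := bounded_eigenvalue_le1 fB fpsi fx0.
by rewrite normfV invf_le1 ?normr_gt0.
Qed.

(** If (f, g) spanned a Jordan block, f would grow linearly along the orbit of any
    point where g does not vanish. *)
Lemma bounded_no_jordan_block f g z B :
  (forall y, `|f y| <= toC B) ->
  (forall y, f (phi y) = z * f y + g y) -> (forall y, g (phi y) = z * g y) ->
  forall x, g x = 0.
Proof.
move=> fB fphi gphi x; apply/eqP/negPn/negP => gx0.
have gB y : `|g y| <= toC (B + `|reC `|z| | * B).
  have -> : g y = f (phi y) - z * f y by rewrite fphi addrC addKr.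
  have [r zr r0] := toC_norm z.
  rewrite (le_trans (ler_normB _ _)) // toCD toCM lerD // normrM zr.
  by rewrite /= (ger0_norm r0) ler_wpM2l // -[0]/(toC 0) toC_le.
have z1 : `|z| = 1 := bounded_eigenvalue_norm1 gB gphi gx0.
have z0 : z != 0 by rewrite -normr_gt0 z1.
(* along the orbit of [x], z^-n f (phi^n x) grows linearly *)
have iterf n : z * f (iter n phi x) = z ^+ n * (z * f x + n%:R * g x)
             /\ g (iter n phi x) = z ^+ n * g x.
  elim: n => [|n [IHf IHg]]; first by rewrite /= !mul1r mul0r addr0.
  rewrite /= fphi gphi mulrDr IHf IHg; split; last by rewrite exprS mulrA.
  by rewrite exprS -natr1; ring.
have [c gc c0] := toC_norm (g x).
have c1 : 0 < c by rewrite -toC_lt -gc normr_gt0.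
have [n] := toC_archi ((B + B) / c).
rewrite -toC_natr toC_lt ltr_pdivrMr // ltNge => /negP; apply.
rewrite -toC_le toCM toC_natr -gc -normr_nat -normrM toCD.
have -> : n%:R * g x = z * f (iter n phi x) / z ^+ n - z * f x.
  by rewrite (iterf n).1 [_ / z ^+ n]mulrC mulKf ?expf_neq0 // addrC addKr.
rewrite (le_trans (ler_normB _ _)) // lerD //.
  by rewrite normrM normfV normrX normrM z1 expr1n mul1r invr1 mulr1.
by rewrite normrM z1 mul1r.
Qed.

End isometry_eigenvalues.

Section commuting_diagonalizable.
Context (F : fieldType) (n : nat) (T : eqType) (A : T -> 'M[F]_n).

(** The span of the family is spanned by finitely many members, which are
    diagonal in a common basis; any other member is a combination of these. *)
Lemma codiagonalizable_family :
  (forall s t, comm_mx (A s) (A t)) -> (forall t, diagonalizable (A t)) ->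
  exists2 P, P \in unitmx & forall t, exists D : 'rV_n, P *m A t = diag_mx D *m P.
Proof.
move=> Acomm Adiag.
(* a finite subfamily whose span has maximal dimension spans the whole family *)
pose dimP k := `[< exists ts : seq T, \dim <<map A ts>>%VS = k >].
have ex0 : exists k, dimP k by exists (\dim <<map A [::]>>%VS); apply/asboolP; exists [::].
have ub k : dimP k -> (k <= \dim {:'M[F]_n})%N.
  by move=> /asboolP[ts <-]; exact/dimvS/subvf.
have [k /asboolP[ts tsk] kmax] := ex_maxnP ex0 ub.
have As t : A t \in <<map A ts>>%VS.
  have sub : (<<map A ts>> <= <<map A (t :: ts)>>)%VS.
    by apply: sub_span => a; rewrite /= in_cons => ->; rewrite orbT.
  have /eqP-> : <<map A ts>>%VS == <<map A (t :: ts)>>%VS.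
    rewrite eqEdim sub tsk; apply: kmax; apply/asboolP; by exists (t :: ts).
  by apply: memv_span; rewrite /= mem_head.
have : codiagonalizable (map A ts).
  apply/codiagonalizableP; split.
    by move=> _ _ /mapP[s _ ->] /mapP[t _ ->].
  by move=> _ /mapP[t _ ->].
move=> [P Pu /allP PA]; exists P => // t.
have PA' s : s \in ts -> exists D : 'rV_n, P *m A s = diag_mx D *m P.
  move=> sts; have /diagonalizable_forPex[D] := PA _ (map_f A sts).
  by move=> /(simmxP Pu) DE; exists D.
have := As t; elim: (ts) (A t) PA' => [|s ts' IH] B PA'.
  rewrite /= span_nil memv0 => /eqP->; exists 0.
  by rewrite mulmx0 linear0 mul0mx.
rewrite /= span_cons => /memv_addP[_ /vlineP[c ->] [B' B'ts' ->]].
have [D1 D1E] := PA' s (mem_head _ _).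
have [|D2 D2E] := IH B' _ B'ts'.
  by move=> u uts'; apply: PA'; rewrite in_cons uts' orbT.
exists (c *: D1 + D2); rewrite mulmxDr -scalemxAr D1E D2E.
by rewrite linearD linearZ /= mulmxDl scalemxAl.
Qed.
End commuting_diagonalizable.

(** The hypothesis says that generalised eigenvectors of order two are
    eigenvectors. It allows multiple roots to be removed one at a time from any
    split polynomial that kills a vector, so the minimal polynomial divides a
    product of distinct linear factors. *)
Lemma semisimple_diagonalizable (F : closedFieldType) (n : nat) (A : 'M[F]_n) :
  (forall z (w : 'rV_n), w *m (A - z%:M) *m (A - z%:M) = 0 ->
     w *m (A - z%:M) = 0) ->
  diagonalizable A.
Proof.
case: n A => [|n] A ssA.
  exists 1%:M; first exact: unitmx1.
  by apply/is_diag_mxP => -[].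
have linE z : horner_mx A ('X - z%:P) = A - z%:M.
  by rewrite rmorphB /= horner_mx_X horner_mx_C.
pose P (r : seq F) := \prod_(z <- r) ('X - z%:P).
have killed r (w : 'rV_n.+1) :
    w *m horner_mx A (P r) = 0 -> w *m horner_mx A (P (undup r)) = 0.
  elim: r w => [//|z r IH] w; rewrite /P big_cons rmorphM /= linE -mulmxE mulmxA.
  move=> /IH; case: ifPn => zr; last first.
    by rewrite big_cons rmorphM /= linE -mulmxE mulmxA.
  have -> : horner_mx A (P (undup r)) =
      horner_mx A (P (rem z (undup r))) *m (A - z%:M).
    by rewrite /P (big_rem z) ?mem_undup //= mulrC rmorphM /= linE.
  have comm q : (A - z%:M) *m horner_mx A q = horner_mx A q *m (A - z%:M).
    by rewrite -linE !mulmxE -!rmorphM mulrC.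
  by rewrite !mulmxA -(mulmxA w) comm mulmxA; exact: ssA.
have [r Er] := closed_field_poly_normal (mxminpoly A).
rewrite (monicP (mxminpoly_monic A)) scale1r in Er.
apply/diagonalizableP; exists (undup r); first exact: undup_uniq.
apply: mxminpoly_min; apply/row_matrixP => i; rewrite row0 rowE; apply: killed.
by rewrite /P -Er mx_root_minpoly mulmx0.
Qed.

(** * Characters and eigenfunctions *)

Section characters.
Context (R : realType) (G : topologicalGroupType).
Implicit Types chi : G -> Cplx R.

Lemma dual_group_conj chi : dual_group chi ->
  (fun t => (chi t)^-1) = (fun t => (chi t)^*).
Proof.
move=> [_ chi1 _]; apply/funext => t.
by rewrite invC_norm chi1 expr1n invr1 mul1r.
Qed.

Lemma dual_group1 chi : dual_group chi -> chi 1%g = 1.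
Proof.
move=> [_ n1 M]; have c0 : chi 1%g != 0 by rewrite -normr_eq0 n1 oner_neq0.
by apply: (mulfI c0); rewrite -M mulg1 mulr1.
Qed.

Lemma dual_groupV chi t : dual_group chi -> chi t^-1%g = (chi t)^*.
Proof.
move=> chiD; have [_ n1 M] := chiD.
have c0 : chi t != 0 by rewrite -normr_eq0 n1 oner_neq0.
by apply: (mulfI c0); rewrite -M mulgV dual_group1 // -normCK n1 expr1n.
Qed.

Lemma dual_groupX chi s k : dual_group chi -> chi (s ^+ k)%g = chi s ^+ k.
Proof.
move=> chiD; have [_ _ M] := chiD; elim: k => [|k IH].
  by rewrite expg0 dual_group1.
by rewrite expgS M IH exprS.
Qed.

End characters.

Section eigenfunctions.
Context (R : realType) (G : topologicalGroupType).

(** The zero function is allowed, which makes the eigenfunctions for chi a vector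
    space, and chi is an arbitrary function: that it is a character is a
    consequence when f is nonzero. *)
Definition eigenfunction (S : tds G) (chi : G -> Cplx R) (f : S -> Cplx R) :=
  continuous f /\ forall t, koopman t f = fun x => chi t * f x.

(** The linear span of the eigenfunctions with eigenvalue in sigma. On an
    irrational rotation of the circle, with sigma the whole dual, these are the
    trigonometric polynomials. *)
Inductive trig_poly (S : tds G) (sigma : set (G -> Cplx R)) : set (S -> Cplx R) :=
| trig_poly0 : trig_poly sigma (fun=> 0)
| trig_polyD chi f g : sigma chi -> eigenfunction chi f ->
    trig_poly sigma g -> trig_poly sigma (fun x => f x + g x).

End eigenfunctions.
Arguments trig_poly {R G} S sigma _.

(** * Finite-dimensional invariant subspaces *)

Section free.
Context (R : realType) (X : Type).
Implicit Types (n : nat).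

Definition lincomb n (e : 'I_n -> X -> Cplx R) (a : 'rV[Cplx R]_n) : X -> Cplx R :=
  fun x => \sum_(i < n) a 0 i * e i x.

Definition independent n (e : 'I_n -> X -> Cplx R) :=
  forall a, lincomb e a = (fun=> 0) -> a = 0.

Lemma lincombD n (e : 'I_n -> X -> Cplx R) a b :
  lincomb e (a + b) = fun x => lincomb e a x + lincomb e b x.
Proof.
apply/funext => x; rewrite /lincomb -big_split /=.
by apply: eq_bigr => i _; rewrite mxE mulrDl.
Qed.

Lemma lincombZ n (e : 'I_n -> X -> Cplx R) c a :
  lincomb e (c *: a) = fun x => c * lincomb e a x.
Proof.
apply/funext => x; rewrite /lincomb mulr_sumr.
by apply: eq_bigr => i _; rewrite mxE mulrA.
Qed.

Lemma lincombB n (e : 'I_n -> X -> Cplx R) a b :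
  lincomb e (a - b) = fun x => lincomb e a x - lincomb e b x.
Proof.
by rewrite -scaleN1r lincombD lincombZ; apply/funext => x; rewrite mulN1r.
Qed.

Lemma lincomb_delta n (e : 'I_n -> X -> Cplx R) i :
  lincomb e (delta_mx 0 i) = e i.
Proof.
apply/funext => x; rewrite /lincomb (bigD1 i) //= mxE !eqxx mul1r big1 ?addr0 //.
by move=> j ji; rewrite mxE (negPf ji) andbF mul0r.
Qed.

Lemma lincomb_mul n m (e : 'I_n -> X -> Cplx R) (a : 'rV_m) (A : 'M[Cplx R]_(m, n)) :
  lincomb e (a *m A) = lincomb (fun i => lincomb e (row i A)) a.
Proof.
apply/funext => x; rewrite /lincomb.
under eq_bigr do rewrite mxE mulr_suml.
rewrite exchange_big /=; apply: eq_bigr => i _; rewrite mulr_sumr.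
by apply: eq_bigr => j _; rewrite mxE mulrA.
Qed.

(** Drop a generator as long as there is a linear relation.  The coefficients over
    the resulting family are unique, so linear operators on the span have
    well-defined matrices. *)
Lemma independent_spanning (P : (X -> Cplx R) -> Prop) n (e : 'I_n -> X -> Cplx R) :
  (forall i, P (e i)) ->
  exists (m : nat) (d : 'I_m -> X -> Cplx R),
    [/\ independent d, forall i, P (d i) & range (lincomb d) = range (lincomb e)].
Proof.
elim: n e => [|n IH] e eP.
  by exists 0%N, e; split=> // a _; apply/rowP => -[].
have [ind|] := pselect (independent e); first by exists n.+1, e.
move=> /existsNP[a /not_implyP[ae0 /eqP a0]].
have [j aj0] : exists j, a 0 j != 0.
  by apply/existsP; apply: contra_neqT a0 => /existsPn aj; apply/rowP => j;
    rewrite mxE; apply/eqP/negPn/aj.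
have [m [d [ind dP dE]]] := IH (fun i => e (lift j i)) (fun i => eP _).
exists m, d; split=> //; rewrite dE.
apply/seteqP; split=> _ [b _ <-].
  exists (\row_k if unlift j k is Some i then b 0 i else 0) => //.
  apply/funext => x; rewrite /lincomb (bigD1_ord j) //= mxE unlift_none mul0r add0r.
  by apply: eq_bigr => i _; rewrite mxE liftK.
pose c := b - (b 0 j / a 0 j) *: a.
exists (\row_i c 0 (lift j i)) => //.
transitivity (lincomb e c).
  apply/funext => x; rewrite /lincomb (bigD1_ord j) //= !mxE divfK // subrr mul0r add0r.
  by apply: eq_bigr => i _; rewrite !mxE.
by rewrite lincombB lincombZ ae0; apply/funext => x; rewrite mulr0 subr0.
Qed.

End free.

Section invariant_subspaces.
Context (R : realType) (G : topologicalGroupType) (S : tds G).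
Implicit Types (f g : S -> Cplx R) (chi : G -> Cplx R) (sigma : set (G -> Cplx R)).

Lemma tds_actK (t : G) : cancel (@tds_act _ S t) (tds_act t^-1%g).
Proof. by move=> x; rewrite -tds_actM mulVg tds_act1. Qed.

Lemma tds_orbit_continuous (x : S) : continuous (fun t : G => tds_act t x).
Proof.
move=> t; apply: (@continuous_comp _ _ _ (fun t : G => (t, x))
  (fun p : G * S => tds_act p.1 p.2)); last exact: tds_act_continuous.
by apply: cvg_pair => /=; [exact: cvg_id|exact: cvg_cst].
Qed.

Lemma tds_act_time_continuous (t : G) : continuous (@tds_act _ S t).
Proof.
move=> x; apply: (@continuous_comp _ _ _ (fun x : S => (t, x))
  (fun p : G * S => tds_act p.1 p.2)); last exact: tds_act_continuous.
by apply: cvg_pair => /=; [exact: cvg_cst|exact: cvg_id].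
Qed.

Lemma tds_bounded f : continuous f -> exists B : R, forall x, `|f x| <= toC B.
Proof. by move=> fc; apply: continuous_bounded fc; case: (tds_compact S). Qed.

Lemma eigenfunction_act chi f t x :
  eigenfunction chi f -> f (tds_act t x) = chi t^-1%g * f x.
Proof.
move=> [_ fE]; rewrite -[RHS](congr1 (@^~ x) (fE t^-1%g)).
by rewrite /koopman /= invgK.
Qed.

(** At a point x where f does not vanish, chi(t) = f(t^-1.x) / f(x); this gives
    continuity and multiplicativity, and boundedness of f forces modulus one. *)
Lemma eigenfunction_dual chi f :
  eigenfunction chi f -> f <> (fun=> 0) -> dual_group chi.
Proof.
move=> [fc fchi] f0.
have [x fx0] : exists x, f x != 0.
  apply: contrapT => /forallNP f0'; apply: f0; apply/funext => x.
  by apply/eqP/negPn/negP => fx0; apply: (f0' x).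
have fE t y : f (tds_act t^-1%g y) = chi t * f y.
  by rewrite -[RHS](congr1 (fun h => h y) (fchi t)).
split.
- have -> : chi = (fun t => f (tds_act t^-1%g x) * (f x)^-1).
    by apply/funext => t; rewrite fE mulfK.
  move=> t; apply: cvgM; last exact: cvg_cst.
  apply: (@continuous_comp _ _ _ (fun t : G => tds_act t^-1%g x) f);
    last exact: fc.
  apply: (@continuous_comp _ _ _ (fun t : G => t^-1%g) (fun t => tds_act t x)).
    exact: invg_continuous.
  exact: tds_orbit_continuous.
- move=> t; have [B fB] := tds_bounded fc.
  exact: (bounded_eigenvalue_norm1 (tds_actK t) fB (fE t) fx0).
- move=> s t; apply: (mulIf fx0).
  by rewrite -fE invgM tds_actM fE fE mulrCA mulrA.
Qed.

Lemma trig_poly_add sigma f g :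
  trig_poly S sigma f -> trig_poly S sigma g -> trig_poly S sigma (fun x => f x + g x).
Proof.
elim=> [|chi h k schi eh kp IH] gp.
  by under [X in trig_poly _ _ X]eq_fun do rewrite add0r.
under [X in trig_poly _ _ X]eq_fun do rewrite -addrA.
by apply: trig_polyD schi eh (IH gp).
Qed.

Lemma eigenfunction_scale chi f c :
  eigenfunction chi f -> eigenfunction chi (fun x => c * f x).
Proof.
move=> [fc fE]; split; first by move=> x; apply: cvgM; [exact: cvg_cst|exact: fc].
move=> t; apply/funext => x.
by have := congr1 (fun h => h x) (fE t); rewrite /koopman /= => ->; rewrite mulrCA.
Qed.

Lemma trig_poly_scale sigma f c :
  trig_poly S sigma f -> trig_poly S sigma (fun x => c * f x).
Proof.
elim=> [|chi h k schi eh kp IH].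
  by under [X in trig_poly _ _ X]eq_fun do rewrite mulr0; exact: trig_poly0.
under [X in trig_poly _ _ X]eq_fun do rewrite mulrDr.
by apply: trig_polyD schi _ IH; exact: eigenfunction_scale.
Qed.

Lemma trig_poly_eigenfunction sigma chi f :
  sigma chi -> eigenfunction chi f -> trig_poly S sigma f.
Proof.
move=> schi ef.
have -> : f = (fun x => f x + 0) by apply/funext => x; rewrite addr0.
exact: trig_polyD schi ef (trig_poly0 _ _).
Qed.

Lemma trig_poly_sum sigma (I : Type) (s : seq I) (F : I -> S -> Cplx R) :
  (forall i, trig_poly S sigma (F i)) ->
  trig_poly S sigma (fun x => \sum_(i <- s) F i x).
Proof.
move=> Fp; elim: s => [|i s IH].
  by under [X in trig_poly _ _ X]eq_fun do rewrite big_nil; exact: trig_poly0.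
by under [X in trig_poly _ _ X]eq_fun do rewrite big_cons; exact: trig_poly_add.
Qed.

Lemma lincomb_continuous m (d : 'I_m -> S -> Cplx R) a :
  (forall i, continuous (d i)) -> continuous (lincomb d a).
Proof.
move=> dc; rewrite /lincomb; elim: (index_enum _) => [|i s IH].
  by under [X in continuous X]eq_fun do rewrite big_nil; exact: cst_continuous.
under [X in continuous X]eq_fun do rewrite big_cons.
move=> x; apply: cvgD; last exact: IH.
by apply: cvgM; [exact: cvg_cst|exact: dc].
Qed.

(** In a basis of M the Koopman operators have commuting matrices, each of them
    diagonalizable because functions in M are bounded. A common diagonalizing
    basis of these matrices is a basis of M made of joint eigenfunctions. *)
Lemma fd_invariant_trig_poly (M : set (S -> Cplx R)) :
  (forall s t : G, (s * t)%g = (t * s)%g) ->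
  fd_subspace M -> koopman_invariant M ->
  M `<=` trig_poly S (@dual_group R G).
Proof.
move=> Gcomm [n [e [ec ME]]] Minv.
have {}ME : M = range (lincomb e).
  rewrite ME; apply/seteqP; split=> [_ [a ->]|_ [a _ <-]].
    exists (\row_i a i) => //.
    by apply/funext => x; apply: eq_bigr => i _; rewrite mxE.
  by exists (a 0).
have [m [d [ind dc dE]]] := independent_spanning ec.
rewrite {}ME -{n e ec}dE in Minv *.
have dinj : injective (lincomb d).
  move=> a b ab; apply/eqP; rewrite -subr_eq0; apply/eqP/ind.
  by rewrite lincombB ab; apply/funext => x; rewrite subrr.
have rangeI i : range (lincomb d) (d i) by exists (delta_mx 0 i); rewrite ?lincomb_delta.
(* A t acts on row vectors, so coordinates are multiplied on the right *)
have /choice[A AE] : forall t, exists A : 'M[Cplx R]_m,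
    forall a, lincomb d (a *m A) = koopman t (lincomb d a).
  move=> t; have /choice[r rE] : forall i, exists r : 'rV_m,
      lincomb d r = koopman t (d i).
    by move=> i; have [r _ rE] := Minv t _ (rangeI i); exists r.
  exists (\matrix_i r i) => a; rewrite lincomb_mul; apply/funext => x.
  by apply: eq_bigr => i _; rewrite rowK rE.
have Acomm s t : comm_mx (A s) (A t).
  apply/row_matrixP => i; rewrite !rowE; apply: dinj.
  rewrite !mulmxA !AE; apply/funext => x; rewrite /koopman /= -!tds_actM.
  by rewrite -!invgM Gcomm.
have dbounded a : exists B : R, forall x, `|lincomb d a x| <= toC B.
  exact/tds_bounded/lincomb_continuous.
have Adiag t : diagonalizable (A t).
  apply: semisimple_diagonalizable => z w wAA; apply: dinj.
  have E v y : lincomb d (v *m (A t - z%:M)) y =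
      lincomb d v (tds_act t^-1%g y) - z * lincomb d v y.
    by rewrite mulmxBr lincombB AE mul_mx_scalar lincombZ.
  rewrite [RHS](_ : _ = fun=> 0); last first.
    by apply/funext => x; rewrite /lincomb big1 // => i _; rewrite mxE mul0r.
  apply/funext => x; have [B wB] := dbounded w.
  apply: (bounded_no_jordan_block (z := z) (tds_actK t) wB) => y.
    by rewrite E [RHS]addrC subrK.
  apply/eqP; rewrite -subr_eq0 -E wAA; apply/eqP.
  by rewrite /lincomb big1 // => i _; rewrite mxE mul0r.
have [P Pu /choice[D DE]] := codiagonalizable_family Acomm Adiag.
pose f k := lincomb d (row k P).
have fchi k : eigenfunction (fun t => D t 0 k) (f k).
  split; first exact: lincomb_continuous.
  move=> t; rewrite /f -AE -row_mul DE -lincombZ; congr lincomb.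
  by apply/rowP => j; rewrite mul_diag_mx !mxE.
have f0 k : f k <> fun=> 0.
  move=> /ind /eqP; apply/negP; rewrite rowE.
  apply/negP => /eqP/(congr1 (mulmx^~ (invmx P))); rewrite mulmxK // mul0mx.
  by move=> /rowP/(_ k)/eqP; rewrite !mxE !eqxx oner_eq0.
move=> _ [a _ <-].
have -> : lincomb d a = fun x => \sum_(k < m) (a *m invmx P) 0 k * f k x.
  by rewrite -[in LHS](mulmxKV Pu a) lincomb_mul.
apply: trig_poly_sum => k; apply: trig_poly_scale.
apply: trig_poly_eigenfunction (fchi k).
exact: eigenfunction_dual (f0 k).
Qed.

End invariant_subspaces.

(** * Discrete spectrum as density of eigenfunctions *)

Lemma uniform_closureP (R : realType) (S : topologicalType)
    (A : set (S -> Cplx R)) (f : S -> Cplx R) :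
  closure (A : set {uniform S -> Cplx R}) f <->
  forall e : R, 0 < e -> exists2 g, A g & forall x, `|f x - g x| < toC e.
Proof.
split=> [clf e e0|fA].
  have e0' : 0 < toC e by rewrite -[0]/(toC 0) toC_lt.
  have [|g [Ag fg]] := clf [set g | forall x, `|f x - g x| < toC e].
    apply/uniform_nbhs; exists [set p : Cplx R * Cplx R | ball p.1 (toC e) p.2].
    split; first exact: (@entourage_ball _ (Cplx R) (PosNum e0')).
    by move=> g /= h x; exact: (h x I).
  by exists g.
move=> U /uniform_nbhs[E [entE EU]].
rewrite -entourage_ballE in entE; have [e' /= e0' e'E] := entE.
have [e e'e ege0] := toC_norm e'.
have [|g Ag fg] := fA e.
  by rewrite -toC_lt -e'e normr_gt0 gt_eqF.
exists g; split=> //; apply: EU => x _; apply: e'E => /=.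
by rewrite /ball /= -(gtr0_norm e0') e'e.
Qed.

Section density.
Context (R : realType) (G : topologicalGroupType) (S : tds G).
Implicit Types (f g : S -> Cplx R) (chi : G -> Cplx R) (sigma : set (G -> Cplx R)).

Lemma trig_polyE sigma g : trig_poly S sigma g ->
  exists n (chi : 'I_n -> G -> Cplx R) (h : 'I_n -> S -> Cplx R),
    [/\ forall i, sigma (chi i), forall i, eigenfunction (chi i) (h i) &
        g = fun x => \sum_(i < n) h i x].
Proof.
elim=> [|chi f k schi ef kp [n [chi' [h [schi' eh ->]]]]].
  exists 0%N, (fun _ _ => 0), (fun _ _ => 0); split; [by case|by case|].
  by apply/funext => x; rewrite big_ord0.
exists n.+1, (fun i => oapp chi' chi (unlift ord0 i)), (fun i => oapp h f (unlift ord0 i)).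
split.
- by move=> i; case: unliftP => [j|] _ /=.
- by move=> i; case: unliftP => [j|] _ /=.
apply/funext => x; rewrite big_ord_recl unlift_none /=; congr (_ + _).
by apply: eq_bigr => i _; rewrite liftK.
Qed.

Lemma discrete_spectrum_dense :
  (forall s t : G, (s * t)%g = (t * s)%g) -> discrete_spectrum R S ->
  forall f (e : R), continuous f -> 0 < e ->
    exists2 g, trig_poly S (@dual_group R G) g & forall x, `|f x - g x| < toC e.
Proof.
move=> Gcomm dS f e /dS /uniform_closureP h /h[g [M [fdM invM] Mg] fg].
by exists g => //; exact: fd_invariant_trig_poly fdM invM _ Mg.
Qed.

(** The eigenfunctions occurring in an element of the span generate a
    finite-dimensional subspace which is invariant. *)
Lemma dense_discrete_spectrum sigma :
  (forall f (e : R), continuous f -> 0 < e ->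
    exists2 g, trig_poly S sigma g & forall x, `|f x - g x| < toC e) ->
  discrete_spectrum R S.
Proof.
move=> dens f /dens fP; apply/uniform_closureP => e /fP[g gp fg].
exists g => //; have [n [chi [h [_ eh ->]]]] := trig_polyE gp.
exists [set f | exists a : 'I_n -> Cplx R, f = fun x => \sum_(i < n) a i * h i x].
  split; first by exists n, h; split=> // i; case: (eh i).
  move=> t _ [a ->]; exists (fun i => chi i t * a i); apply/funext => x.
  apply: eq_bigr => i _; have [_ /(_ t)/(congr1 (fun k => k x))] := eh i.
  by rewrite /koopman /= => ->; rewrite mulrCA mulrA.
by exists (fun=> 1); apply/funext => x; apply: eq_bigr => i _; rewrite mul1r.
Qed.

Lemma trig_poly_continuous sigma g : trig_poly S sigma g -> continuous g.
Proof.
elim=> [|chi f k _ [fc _] _ kc]; first exact: cst_continuous.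
by move=> x; apply: cvgD; [exact: fc|exact: kc].
Qed.

Lemma eigenfunction_mul chi eta f g : eigenfunction chi f -> eigenfunction eta g ->
  eigenfunction (fun t => chi t * eta t) (fun x => f x * g x).
Proof.
move=> [fc fE] [gc gE]; split; first by move=> x; apply: cvgM; [exact: fc|exact: gc].
move=> t; apply/funext => x; rewrite mulrACA.
by rewrite -[chi t * f x](congr1 (@^~ x) (fE t)) -[eta t * g x](congr1 (@^~ x) (gE t)).
Qed.

Lemma eigenfunction_conj chi f : eigenfunction chi f ->
  eigenfunction (fun t => (chi t)^*) (fun x => (f x)^*).
Proof.
move=> [fc fE]; split.
  move=> x; apply: (@continuous_comp _ _ _ f (fun z : Cplx R => z^*));
    [exact: fc|exact: conjC_continuous].
move=> t; apply/funext => x; rewrite -rmorphM.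
by rewrite -[chi t * f x](congr1 (@^~ x) (fE t)).
Qed.

Lemma trig_poly_mul sigma f g :
  (forall chi eta, sigma chi -> sigma eta -> sigma (fun t => chi t * eta t)) ->
  trig_poly S sigma f -> trig_poly S sigma g -> trig_poly S sigma (fun x => f x * g x).
Proof.
move=> sM; elim=> [|chi h k schi eh kp IH] gp.
  by under [X in trig_poly _ _ X]eq_fun do rewrite mul0r; exact: trig_poly0.
under [X in trig_poly _ _ X]eq_fun do rewrite mulrDl.
apply: trig_poly_add; last exact: IH.
elim: {IH} gp => [|eta p q seta ep qp IH].
  by under [X in trig_poly _ _ X]eq_fun do rewrite mulr0; exact: trig_poly0.
under [X in trig_poly _ _ X]eq_fun do rewrite mulrDr.
by apply: trig_polyD (sM _ _ schi seta) _ IH; exact: eigenfunction_mul.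
Qed.

Lemma trig_poly_conj sigma f :
  (forall chi, sigma chi -> sigma (fun t => (chi t)^*)) ->
  trig_poly S sigma f -> trig_poly S sigma (fun x => (f x)^*).
Proof.
move=> sJ; elim=> [|chi h k schi eh kp IH].
  by under [X in trig_poly _ _ X]eq_fun do rewrite rmorph0; exact: trig_poly0.
under [X in trig_poly _ _ X]eq_fun do rewrite rmorphD.
by apply: trig_polyD (sJ _ schi) _ IH; exact: eigenfunction_conj.
Qed.

Lemma trig_poly_cst sigma c : sigma (fun=> 1) -> trig_poly S sigma (fun=> c).
Proof.
move=> s1; apply: trig_poly_eigenfunction s1 _.
by split=> [|t]; [exact: cst_continuous|apply/funext => x; rewrite mul1r].
Qed.

(** Products and conjugates of eigenfunctions are eigenfunctions for the products
    and inverses of their characters. As sigma is a group, the span is a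
    self-conjugate unital algebra, and Stone-Weierstrass applies. *)
Lemma separating_trig_poly_dense sigma :
  dual_subgroup sigma ->
  (forall x y : S, x != y -> exists chi f,
     [/\ sigma chi, eigenfunction chi f & f x != f y]) ->
  forall f (e : R), continuous f -> 0 < e ->
    exists2 g, trig_poly S sigma g & forall x, `|f x - g x| < toC e.
Proof.
move=> [sdual s1 sM sV] sep.
apply: complex_stone_weierstrass.
- by case: (tds_compact S).
- exact: trig_poly_continuous.
- by move=> c; exact: trig_poly_cst.
- exact: trig_poly_add.
- by move=> f g; exact: trig_poly_mul.
- move=> f; apply: trig_poly_conj => chi schi.
  by rewrite -dual_group_conj; [exact: sV|exact: sdual].
- move=> x y /sep[chi [f [schi ef fxy]]]; exists f => //.
  exact: trig_poly_eigenfunction schi ef.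
Qed.

End density.

(** * The group compactification attached to a set of characters *)

Lemma ptws_continuous (Z : topologicalType) (I : Type) (V : topologicalType)
    (f : Z -> {ptws I -> V}) :
  (forall i, continuous (fun z => f z i)) -> continuous f.
Proof.
move=> fc z; apply/cvg_sup => i U [_ [[W oW <-] Wfz]] /filterS; apply.
by apply: (fc i z); exact: open_nbhs_nbhs.
Qed.

Lemma ptws_eval_continuous (I : Type) (V : topologicalType) (i : I) :
  continuous (fun h : {ptws I -> V} => h i).
Proof. exact: (@proj_continuous {classic I} (fun=> V) i). Qed.

Lemma closure_image (X Y : topologicalType) (f : X -> Y) (A : set X) (B : set Y) :
  continuous f -> (forall x, A x -> closure B (f x)) ->
  forall x, closure A x -> closure B (f x).
Proof.
move=> fc AB x Ax; apply: (@closed_closure _ B) => U /fc /Ax[y [Ay Uy]].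
by exists (f y); split=> //; exact: AB.
Qed.

Section character_compactification.
Context (R : realType) (G : topologicalGroupType).
Context (sigma : set (G -> Cplx R)).

(** Intersecting with the dual group makes the construction available for an
    arbitrary sigma, without a hypothesis carried by the types below. *)
Definition char_index := set_type (sigma `&` @dual_group R G).

Definition char_space := {ptws char_index -> Cplx R}.

(** The inverse matches the Koopman convention f o t^-1: with it the coordinate
    of index chi is an eigenfunction for chi itself and not for its inverse. *)
Definition char_eval (t : G) : char_space := fun chi => set_val chi t^-1%g.

(** The underlying compact group; it is a group because it is the closure of a
    group of families of complex numbers of modulus one. *)
Definition char_hull : Type := set_type (closure (range char_eval)).

HB.instance Definition _ := Topological.on char_hull.

Implicit Types (x y : char_hull) (chi : char_index).

Definition hull_val x : char_space := set_val x.

Lemma hull_val_inj : injective hull_val.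
Proof. by move=> x y; apply: val_inj. Qed.

Lemma hull_valP x : closure (range char_eval) (hull_val x).
Proof. exact: set_valP. Qed.
Arguments hull_valP : clear implicits.

Lemma char_dual chi : dual_group (set_val chi).
Proof. by have [] := set_valP chi. Qed.

Lemma charM chi s t : set_val chi (s * t)%g = set_val chi s * set_val chi t.
Proof. by have [_ _ h] := char_dual chi; exact: h. Qed.

Lemma char_norm chi t : `|set_val chi t| = 1.
Proof. by have [_ h _] := char_dual chi; exact: h. Qed.

Lemma char_continuous chi : continuous (set_val chi : G -> Cplx R).
Proof. by have [h _ _] := char_dual chi; exact: h. Qed.

Lemma char1 chi : set_val chi 1%g = 1.
Proof. exact: dual_group1 (char_dual chi). Qed.

Lemma charV chi t : set_val chi t^-1%g = (set_val chi t)^*.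
Proof. exact: dual_groupV (char_dual chi). Qed.

(** The families of numbers of modulus one form a closed set. *)
Lemma hull_norm x chi : `|hull_val x chi| = 1.
Proof.
pose K := [set h : char_space | `|h chi| = 1].
have Kclosed : closed K.
  apply: (@preimage_closed _ _ (fun h : char_space => h chi)
    [set z : Cplx R | `|z| = 1]).
    by move=> h _; exact: ptws_eval_continuous.
  exact: (compact_closed (@Cplx_hausdorff R) (@circle_compact R)).
have sub : range char_eval `<=` K by move=> _ [t _ <-]; exact: char_norm.
exact: (Kclosed _ (closureS sub (hull_valP x))).
Qed.

Definition mkhull (h : char_space) (hP : closure (range char_eval) h) : char_hull :=
  exist _ h (mem_set hP).

(** Closure is preserved first under multiplication by a point of G, then, the
    second factor being arbitrary in the closure, in the first factor. *)
Fact hull_mul_subproof x y :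
  closure (range char_eval) (fun chi => hull_val x chi * hull_val y chi).
Proof.
have mulc (h : char_space) : continuous (fun k : char_space => (fun chi => k chi * h chi) : char_space).
  apply: ptws_continuous => chi.
  apply: (@Cplx_mul_continuous R _ (fun k : char_space => k chi) (fun=> h chi)).
    exact: ptws_eval_continuous.
  exact: cst_continuous.
apply: (closure_image (mulc (hull_val y)) _ (hull_valP x)) => _ [s _ <-].
have := closure_image (mulc (char_eval s)) _ (hull_valP y).
rewrite (_ : (fun chi => hull_val y chi * char_eval s chi) =
  (fun chi => char_eval s chi * hull_val y chi)); last first.
  by apply/funext => chi; rewrite mulrC.
apply=> _ [t _ <-]; apply: subset_closure; exists (s * t)%g => //.
by apply/funext => chi; rewrite /char_eval invgM charM.
Qed.

(** On the circle the inverse is the conjugate, which is continuous everywhere. *)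
Fact hull_inv_subproof x : closure (range char_eval) (fun chi => (hull_val x chi)^*).
Proof.
have conjc : continuous (fun h : char_space => (fun chi => (h chi)^*) : char_space).
  apply: ptws_continuous => chi h.
  apply: (@continuous_comp _ _ _ (fun h : char_space => h chi) (fun z : Cplx R => z^*)).
    exact: ptws_eval_continuous.
  exact: conjC_continuous.
apply: (closure_image conjc _ (hull_valP x)) => _ [t _ <-].
apply: subset_closure; exists t^-1%g => //.
by apply/funext => chi; rewrite /char_eval charV.
Qed.

Definition hull_point t : char_hull := mkhull (subset_closure (imageT char_eval t)).
Definition hull_mul x y := mkhull (@hull_mul_subproof x y).
Definition hull_inv x := mkhull (@hull_inv_subproof x).

Lemma hull_eqP x y : (forall chi, hull_val x chi = hull_val y chi) -> x = y.
Proof. by move=> xy; apply: hull_val_inj; apply/funext. Qed.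

Lemma hull_val_mul x y chi : hull_val (hull_mul x y) chi = hull_val x chi * hull_val y chi.
Proof. by []. Qed.
Lemma hull_val_inv x chi : hull_val (hull_inv x) chi = (hull_val x chi)^*.
Proof. by []. Qed.
Lemma hull_val_point t chi : hull_val (hull_point t) chi = set_val chi t^-1%g.
Proof. by []. Qed.

Fact hull_mulA : associative hull_mul.
Proof. by move=> x y z; apply: hull_eqP => chi; rewrite !hull_val_mul mulrA. Qed.
Fact hull_1mul : left_id (hull_point 1%g) hull_mul.
Proof.
by move=> x; apply: hull_eqP => chi; rewrite hull_val_mul hull_val_point charV char1 rmorph1 mul1r.
Qed.
Fact hull_mul1 : right_id (hull_point 1%g) hull_mul.
Proof.
by move=> x; apply: hull_eqP => chi; rewrite hull_val_mul hull_val_point charV char1 rmorph1 mulr1.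
Qed.
Fact hull_Vmul : left_inverse (hull_point 1%g) hull_inv hull_mul.
Proof.
move=> x; apply: hull_eqP => chi; rewrite hull_val_mul hull_val_point hull_val_inv.
by rewrite charV char1 rmorph1 mulrC -normCK hull_norm expr1n.
Qed.
Fact hull_mulV : right_inverse (hull_point 1%g) hull_inv hull_mul.
Proof.
move=> x; apply: hull_eqP => chi; rewrite hull_val_mul hull_val_point hull_val_inv.
by rewrite charV char1 rmorph1 -normCK hull_norm expr1n.
Qed.

HB.instance Definition _ := isGroup.Build char_hull
  hull_mulA hull_1mul hull_mul1 hull_Vmul hull_mulV.

Lemma hull_continuous (Z : topologicalType) (f : Z -> char_hull) :
  (forall chi, continuous (fun z => hull_val (f z) chi)) -> continuous f.
Proof.
move=> fc; apply: (@continuous_comp_initial _ _ _ (@hull_val)).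
exact: ptws_continuous.
Qed.

Lemma hull_val_continuous chi : continuous (fun x => hull_val x chi).
Proof.
move=> x; apply: (@continuous_comp _ _ _ hull_val (fun h : char_space => h chi)).
  exact: initial_continuous.
exact: ptws_eval_continuous.
Qed.

Fact hull_mulg_continuous : continuous (fun p : char_hull * char_hull => (p.1 * p.2)%g).
Proof.
apply: hull_continuous => chi.
apply: (@Cplx_mul_continuous R _ (fun p : char_hull * char_hull => hull_val p.1 chi)
  (fun p => hull_val p.2 chi)) => p.
  apply: (@continuous_comp _ _ _ fst (fun x => hull_val x chi)); first exact: cvg_fst.
  exact: hull_val_continuous.
apply: (@continuous_comp _ _ _ snd (fun x => hull_val x chi)); first exact: cvg_snd.
exact: hull_val_continuous.
Qed.

Fact hull_invg_continuous : continuous (fun x : char_hull => x^-1%g).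
Proof.
apply: hull_continuous => chi x.
apply: (@continuous_comp _ _ _ (fun x => hull_val x chi) (fun z : Cplx R => z^*)).
  exact: hull_val_continuous.
exact: conjC_continuous.
Qed.

HB.instance Definition _ := PreTopologicalGroup_isTopologicalGroup.Build char_hull
  hull_mulg_continuous hull_invg_continuous.

(** A closed subset of a product of circles, compact by Tychonoff's theorem. *)
Lemma closure_range_compact : compact (closure (range char_eval)).
Proof.
have cT : compact [set h : char_space | forall chi, `|h chi| = 1].
  exact: (@tychonoff {classic char_index} (fun=> Cplx R)
    (fun=> [set z : Cplx R | `|z| = 1]) (fun=> @circle_compact R)).
apply: (subclosed_compact (@closed_closure _ _) cT) => h hP chi.
exact: (hull_norm (mkhull hP) chi).
Qed.

Lemma hull_compact : compact_space char_hull.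
Proof.
split; last by exists (hull_point 1%g).
  move=> F FF _.
  have [|h [hP clh]] := @closure_range_compact (hull_val @ F) _.
    by apply: (@filterS _ F _ setT) filterT => x _; exact: hull_valP.
  exists (mkhull hP); split=> // U V FU [_ [[W oW <-] Wh]] WV.
  have [|_ [[x Ux <-] Wx]] := clh (hull_val @` U) W _ (open_nbhs_nbhs (conj oW Wh)).
    by apply: (@filterS _ F _ U) FU => x Ux; exists x.
  by exists x; split=> //; exact: WV.
move=> x y xy; apply: hull_eqP => chi.
have haus := @Cplx_hausdorff R (hull_val x chi) (hull_val y chi).
apply: haus => U V Ux Vy.
have [z [Uz Vz]] := xy _ _ (hull_val_continuous Ux) (hull_val_continuous Vy).
by exists (hull_val z chi).
Qed.

Lemma hull_point_continuous : continuous hull_point.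
Proof.
apply: hull_continuous => chi t.
apply: (@continuous_comp _ _ _ (fun t : G => t^-1%g) (set_val chi : G -> Cplx R)).
  exact: invg_continuous.
exact: char_continuous.
Qed.

Lemma hull_pointM : {morph hull_point : s t / (s * t)%g}.
Proof.
move=> s t; apply: hull_eqP => chi.
by rewrite hull_val_mul !hull_val_point invgM charM mulrC.
Qed.

Lemma hull_point_dense : dense (range hull_point).
Proof.
move=> O [x Ox] [W oW WO].
have [|_ [[t _ <-] Wt]] := hull_valP x W.
  by apply: open_nbhs_nbhs; split=> //; move: Ox; rewrite -WO.
by exists (hull_point t); split=> //; rewrite -WO.
Qed.

Definition char_compactification : group_compactification G :=
  @GroupCompactification G char_hull hull_point hull_compact hull_point_continuous
    hull_pointM hull_point_dense.

End character_compactification.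

(** * Approximate independence of characters *)

Section characters_separation.
Context (R : realType) (G : topologicalGroupType).
Implicit Types (chi eta : G -> Cplx R).

Lemma geometric_average_small (z : Cplx R) N : `|z| = 1 -> z != 1 ->
  `|N.+1%:R^-1 * \sum_(k < N.+1) z ^+ k| <= 2 / `|1 - z| / N.+1%:R.
Proof.
move=> z1 zn1; have z0 : 1 - z != 0 by rewrite subr_eq0 eq_sym.
have -> : \sum_(k < N.+1) z ^+ k = (1 - z ^+ N.+1) / (1 - z).
  by apply: (mulIf z0); rewrite divfK // mulrC -opprB mulNr -subrX1 opprB.
rewrite normrM normfV normr_nat mulrC ler_pM2r ?invr_gt0 ?ltr0n //.
rewrite normrM normfV ler_pM2r ?invr_gt0 ?normr_gt0 //.
by rewrite (le_trans (ler_normB _ _)) // normr1 normrX z1 expr1n.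
Qed.

(** Let s0 be such that chi_0(s0) <> eta(s0). Averaging eta(s0)^-k times the
    translate by s0^k over k <= N fixes b * eta, only changes the coefficients of
    the other characters, does not increase the bound r, and multiplies the
    coefficient of chi_0 by a factor O(1/N).  So chi_0 can be dropped at the
    price of an error that tends to 0, and one concludes by induction. *)
Lemma character_coefficient_bound n (chi : 'I_n -> G -> Cplx R) eta
    (a : 'I_n -> Cplx R) (b : Cplx R) (r : R) :
  dual_group eta -> (forall i, dual_group (chi i)) -> (forall i, chi i <> eta) ->
  (forall s, `|b * eta s - \sum_(i < n) a i * chi i s| <= toC r) ->
  `|b| <= toC r.
Proof.
move=> etaD; have [_ eta1 etaM] := etaD.
elim: n chi a r => [|n IH] chi a r chiD chin bound.
  have := bound 1%g; rewrite big_ord0 subr0 dual_group1 // mulr1; exact.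
have [s0 s0P] : exists s, chi ord0 s <> eta s.
  by apply: contrapT => /forallNP h; apply: (chin ord0); apply/funext => s;
     apply: contrapT => /(h s).
have eta0 s : eta s != 0 by rewrite -normr_eq0 eta1 oner_neq0.
pose z i := chi i s0 / eta s0.
have z1 i : `|z i| = 1.
  by have [_ chi1 _] := chiD i; rewrite normrM normfV chi1 eta1 divr1.
have zn1 : z ord0 != 1.
  by apply/eqP => /(congr1 (fun w => w * eta s0)); rewrite mul1r divfK.
pose c N i := N.+1%:R^-1 * \sum_(k < N.+1) z i ^+ k.
have average N s :
    `|b * eta s - \sum_(i < n.+1) (a i * c N i) * chi i s| <= toC r.
  have -> : b * eta s - \sum_(i < n.+1) (a i * c N i) * chi i s =
    N.+1%:R^-1 * \sum_(k < N.+1) (eta s0 ^- k *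
      (b * eta (s * s0 ^+ k)%g - \sum_(i < n.+1) a i * chi i (s * s0 ^+ k)%g)).
    have term (k : 'I_N.+1) : eta s0 ^- k *
        (b * eta (s * s0 ^+ k)%g - \sum_(i < n.+1) a i * chi i (s * s0 ^+ k)%g) =
        b * eta s - \sum_(i < n.+1) z i ^+ k * (a i * chi i s).
      have ek0 := expf_neq0 k (eta0 s0).
      rewrite mulrBr mulr_sumr etaM dual_groupX //; congr (_ - _).
        by set u := eta s0 ^+ k in ek0 *; field.
      apply: eq_bigr => i _; have [_ _ chiM] := chiD i.
      rewrite chiM dual_groupX // expr_div_n.
      by set u := eta s0 ^+ k in ek0 *; field.
    under [in RHS]eq_bigr do rewrite term.
    rewrite sumrB mulrBr sumr_const card_ord -[(b * _) *+ _]mulr_natl.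
    rewrite mulKf ?pnatr_eq0 //; congr (_ - _).
    rewrite [in RHS]exchange_big /= [RHS]mulr_sumr; apply: eq_bigr => i _.
    by rewrite -mulr_suml /c; set w := \sum_(k < _) _; ring.
  rewrite normrM normfV normr_nat mulrC ler_pdivrMr ?ltr0n //.
  rewrite (le_trans (ler_norm_sum _ _ _)) // mulr_natr.
  rewrite -[X in _ *+ X]card_ord -sumr_const; apply: ler_sum => k _.
  by rewrite normrM normfV normrX eta1 expr1n invr1 mul1r.
have [K KE K0] := toC_norm (`|a ord0| * (2 / `|1 - z ord0|)).
have bN N : `|b| <= toC (r + K / N.+1%:R).
  apply: (IH (fun i => chi (lift ord0 i)) (fun i => a (lift ord0 i) * c N (lift ord0 i))).
  - by move=> i.
  - by move=> i; exact: chin.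
  move=> s; have := average N s; rewrite big_ord_recl => h.
  set d := \sum_(i < n) _ in h *.
  have -> : b * eta s - d =
      (b * eta s - (a ord0 * c N ord0 * chi ord0 s + d)) + a ord0 * c N ord0 * chi ord0 s.
    by ring.
  rewrite (le_trans (ler_normD _ _)) // toCD lerD //.
  have [_ chi1 _] := chiD ord0; rewrite normrM chi1 mulr1 normrM.
  have -> : toC (K / N.+1%:R) = `|a ord0| * (2 / `|1 - z ord0| / N.+1%:R).
    rewrite toCM toCV toC_natr -KE.
    rewrite ger0_norm ?mulrA // mulr_ge0 ?divr_ge0 //.
  by apply: ler_wpM2l => //; exact: geometric_average_small.
have [be bE be0] := toC_norm b; rewrite bE toC_le leNgt; apply/negP => rb.
have [N] := toC_archi (K / (be - r)); rewrite -toC_natr toC_lt => KN.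
have := bN N; rewrite bE toC_le leNgt => /negP; apply.
rewrite -ltrBrDl ltr_pdivrMr ?ltr0n //.
rewrite ltr_pdivrMr ?subr_gt0 // in KN.
rewrite (lt_trans KN) // mulrC ltr_pM2l ?subr_gt0 // ltr_nat //.
Qed.

End characters_separation.

(** * Isomorphisms of systems *)

Section isomorphisms.
Context (R : realType) (G : topologicalGroupType).
Implicit Types (S : tds G).

Lemma tds_isomorphic_sym S1 S2 : tds_isomorphic S1 S2 -> tds_isomorphic S2 S1.
Proof.
move=> [q [qc [q' [qc' qK q'K]] qT]]; exists q'; split=> //; first by exists q.
move=> t; apply/funext => y /=; apply: (can_inj qK).
by have := congr1 (@^~ (q' y)) (qT t); rewrite /= !q'K.
Qed.

Lemma tds_isomorphic_trans S1 S2 S3 :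
  tds_isomorphic S1 S2 -> tds_isomorphic S2 S3 -> tds_isomorphic S1 S3.
Proof.
move=> [q [qc [q' [qc' qK q'K]] qT]] [p [pc [p' [pc' pK p'K]] pT]].
exists (p \o q); split.
- by move=> x; apply: continuous_comp; [exact: qc|exact: pc].
- exists (q' \o p'); split; [|exact: can_comp|exact: can_comp].
  by move=> x; apply: continuous_comp; [exact: pc'|exact: qc'].
- by move=> t; rewrite -compA qT compA pT.
Qed.

Lemma isomorphic_point_spectrum_sub S1 S2 : tds_isomorphic S1 S2 ->
  point_spectrum R S1 `<=` point_spectrum R S2.
Proof.
move=> /tds_isomorphic_sym[q [qc [q' [qc' qK q'K]] qT]] chi [chiD [f [fc f0 fE]]].
split=> //; exists (f \o q); split.
- by move=> x; apply: continuous_comp; [exact: qc|exact: fc].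
- move=> fq0; apply: f0; apply/funext => x.
  by rewrite -(q'K x); exact: (congr1 (@^~ (q' x)) fq0).
- move=> t; apply/funext => x.
  rewrite -[RHS](congr1 (@^~ (q x)) (fE t)) /koopman /=.
  by congr f; exact: (congr1 (@^~ x) (qT t^-1%g)).
Qed.

(** A continuous bijection from a compact space to a Hausdorff space is a
    homeomorphism. *)
Lemma bijective_equivariant_isomorphic S1 S2 (q : S1 -> S2) :
  continuous q -> injective q -> (forall y, exists x, q x = y) ->
  (forall t x, q (tds_act t x) = tds_act t (q x)) -> tds_isomorphic S1 S2.
Proof.
move=> qc qinj /choice[q' qq'] qT; exists q; split=> //; last first.
  by move=> t; apply/funext => x; exact: qT.
have q'q : cancel q q' by move=> x; apply: qinj; rewrite qq'.
exists q'; split=> //; apply/continuous_closedP => A clA.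
have [c1 _ _] := tds_compact S1; have [_ h2 _] := tds_compact S2.
rewrite (_ : q' @^-1` A = q @` A); last first.
  apply/seteqP; split=> [y Ay|_ [x Ax <-]] /=; last by rewrite q'q.
  by exists (q' y).
apply: (compact_closed h2); apply: continuous_compact.
  exact: continuous_subspaceT.
exact: (subclosed_compact clA c1).
Qed.

End isomorphisms.

(** * Minimal systems with discrete spectrum *)

Section minimal_systems.
Context (R : realType) (G : topologicalGroupType) (S : tds G).
Context (Smin : minimal S).
Implicit Types (f g : S -> Cplx R) (chi : G -> Cplx R).

Lemma minimal_setT (A : set S) x : closed A ->
  (forall t y, A y -> A (tds_act t y)) -> A x -> A = [set: S].
Proof.
move=> clA invA Ax; have [|A0|//] := Smin clA.
  by move=> t _ [y Ay <-]; exact: invA.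
by move: Ax; rewrite A0.
Qed.

Lemma minimal_orbit_dense (x y : S) :
  closure (range (fun t : G => tds_act t x)) y.
Proof.
rewrite (@minimal_setT _ x (@closed_closure _ _)) //.
  move=> t; apply: closure_image; first exact: tds_act_time_continuous.
  move=> _ [s _ <-]; apply: subset_closure; exists (t * s)%g => //.
  by rewrite tds_actM.
by apply: subset_closure; exists 1%g; rewrite ?tds_act1.
Qed.

(** Characters have modulus one, so the level sets of |f| are closed invariant
    sets. *)
Lemma eigenfunction_modulus chi f x y :
  dual_group chi -> eigenfunction chi f -> `|f x| = `|f y|.
Proof.
move=> [_ chi1 _] ef.
pose A := [set z | `|f z| - `|f y| = 0].
have clA : closed A.
  apply: (@preimage_closed _ _ (fun z => `|f z| - `|f y|) [set 0]).
    move=> z _; apply: cvgB; last exact: cvg_cst.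
    apply: (@continuous_comp _ _ _ f (fun w : Cplx R => `|w|)).
      by case: ef => fc _; exact: fc.
    exact: Cplx_norm_continuous.
  exact/accessible_closed_set1/hausdorff_accessible/Cplx_hausdorff.
have AT : A = [set: S].
  apply: (minimal_setT clA (x := y)); last by rewrite /A /= subrr.
  by move=> t z; rewrite /A /= (eigenfunction_act _ _ ef) normrM chi1 mul1r.
by have : A x by [rewrite AT]; move=> /eqP; rewrite subr_eq0 => /eqP.
Qed.

(** The difference of f and g is an eigenfunction of constant modulus vanishing at
    x0. *)
Lemma eigenfunction_unique chi f g x0 : dual_group chi ->
  eigenfunction chi f -> eigenfunction chi g -> f x0 = g x0 -> f = g.
Proof.
move=> chiD [fc fE] [gc gE] fg0.
have eh : eigenfunction chi (fun x => f x - g x).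
  split; first by move=> x; apply: cvgB; [exact: fc|exact: gc].
  move=> t; apply/funext => x; rewrite mulrBr.
  by rewrite -[chi t * f x](congr1 (@^~ x) (fE t)) -[chi t * g x](congr1 (@^~ x) (gE t)).
apply/funext => x; apply/eqP; rewrite -subr_eq0 -normr_eq0.
by rewrite (eigenfunction_modulus x x0 chiD eh) fg0 subrr normr0.
Qed.

Lemma normalized_eigenfunction chi x0 : point_spectrum R S chi ->
  exists f, eigenfunction chi f /\ f x0 = 1.
Proof.
move=> [chiD [f [fc f0 fE]]]; have ef : eigenfunction chi f by [].
have fx0 : f x0 != 0.
  apply/eqP => fx0; apply: f0; apply/funext => x; apply/eqP.
  by rewrite -normr_eq0 (eigenfunction_modulus x x0 chiD ef) fx0 normr0.
exists (fun x => (f x0)^-1 * f x); split; last by rewrite mulVf.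
exact: eigenfunction_scale.
Qed.

Context (Gcomm : forall s t : G, (s * t)%g = (t * s)%g).
Context (Sdisc : discrete_spectrum R S).

(** The isomorphism is x |-> (f_chi(x))_chi, with f_chi the eigenfunction for chi
    normalised at a base point x0. It is injective because a pair of points not
    separated by eigenfunctions is not separated by any continuous function, and
    surjective because its compact image contains the dense image of G, which is
    the image of the orbit of x0. *)
Lemma minimal_isomorphic_rotation :
  tds_isomorphic S (rotation (char_compactification (point_spectrum R S))).
Proof.
have [_ _ [x0 _]] := tds_compact S.
set sigma := point_spectrum R S.
have /choice[F FE] : forall chi : char_index sigma, exists f : S -> Cplx R,
    eigenfunction (set_val chi) f /\ f x0 = 1.
  by move=> chi; apply: normalized_eigenfunction; have [] := set_valP chi.
have FA (chi : char_index sigma) t x : F chi (tds_act t x) = set_val chi t^-1%g * F chi x.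
  by apply: eigenfunction_act; case: (FE chi).
pose J x : char_space sigma := fun chi : char_index sigma => F chi x.
have Jc : continuous J.
  by apply: ptws_continuous => chi; case: (FE chi) => -[].
have JP x : closure (range (@char_eval R G sigma)) (J x).
  apply: (closure_image Jc _ (@minimal_orbit_dense x0 x)) => _ [t _ <-].
  apply: subset_closure; exists t => //; apply/funext => chi.
  by rewrite /J FA (FE chi).2 mulr1.
pose q x : char_hull sigma := mkhull (JP x).
have qc : continuous q.
  by apply: hull_continuous => chi; case: (FE chi) => -[].
have qT t x : q (tds_act t x) = (hull_point sigma t * q x)%g.
  by apply: hull_eqP => chi; rewrite hull_val_mul; exact: FA.
apply: (@bijective_equivariant_isomorphic G S
   (rotation (char_compactification sigma)) q) => //.
- move=> x y qxy; have [cS hS _] := tds_compact S.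
  apply: (@continuous_separates R S x y cS hS) => f fc.
  have Fxy (chi : char_index sigma) : F chi x = F chi y by exact: (congr1 (fun h => hull_val h chi) qxy).
  have ef_xy chi g : dual_group chi -> eigenfunction chi g -> g x = g y.
    move=> chiD eg; have [->//|g0] := pselect (g = fun=> 0).
    have chis : (sigma `&` @dual_group R G) chi.
      by split=> //; split=> //; exists g; case: eg.
    pose i : char_index sigma := exist _ chi (mem_set chis).
    have -> : g = (fun x => g x0 * F i x).
      apply: (eigenfunction_unique chiD eg _ (x0 := x0)).
        by apply: eigenfunction_scale; case: (FE i).
      by rewrite (FE i).2 mulr1.
    by rewrite Fxy.
  have trig_xy g : trig_poly S (@dual_group R G) g -> g x = g y.
    by elim=> // chi h k chiD eh _ ->; rewrite (ef_xy _ _ chiD eh).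
  apply/eqP; rewrite -subr_eq0 -normr_eq0.
  have [r rE r0] := toC_norm (f x - f y); rewrite rE.
  suff : r <= 0 by move=> rle; rewrite (le_anti (_ : r <= 0 <= r)) // rle r0.
  rewrite leNgt; apply/negP => rgt0.
  have r2 : 0 < r / 2 by rewrite divr_gt0.
  have [g /trig_xy gxy fg] := discrete_spectrum_dense Gcomm Sdisc fc r2.
  have : `|f x - f y| < toC r.
    have -> : f x - f y = (f x - g x) - (f y - g y) by rewrite gxy; ring.
    by rewrite (le_lt_trans (ler_normB _ _)) // [r]splitr toCD ltrD.
  by rewrite rE ltxx.
- move=> y; apply: contrapT => /forallNP yq.
  have [c1 _ _] := tds_compact S; have [_ h2 _] := hull_compact sigma.
  have clq : closed (range q).
    by apply: (compact_closed h2); apply: continuous_compact => //;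
       exact: continuous_subspaceT.
  have [||z [nq [t _ tE]]] := @hull_point_dense R G sigma (~` range q).
  + by exists y => -[x _]; exact: yq.
  + exact: closed_openC.
  apply: nq; exists (tds_act t x0) => //; rewrite -tE; apply: hull_eqP => chi.
  by rewrite -[LHS]/(F chi (tds_act t x0)) FA (FE chi).2 mulr1.
Qed.

End minimal_systems.

(** * Rotations on group compactifications *)

(** If A is closed, invariant and contains a, the closed set of those g with g * a
    in A contains the dense image of G, hence is the whole group. *)
Lemma rotation_minimal (G : topologicalGroupType) (H : group_compactification G) :
  minimal (rotation H).
Proof.
move=> A clA invA; have [[a Aa]|A0] := pselect (A !=set0); last first.
  by left; apply/seteqP; split=> // x Ax; apply: A0; exists x.
right; apply/seteqP; split=> // x _.
pose B := [set g : H | A (g * a)%g].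
have mulc : continuous (fun g : H => (g * a)%g).
  move=> g; apply: (@continuous_comp _ _ _ (fun g : H => (g, a))
    (fun p : H * H => (p.1 * p.2)%g)); last exact: mulg_continuous.
  by apply: cvg_pair => /=; [exact: cvg_id|exact: cvg_cst].
have clB : closed B by apply: (@preimage_closed _ _ _ A) => // g _; exact: mulc.
suff : B (x * a^-1)%g by rewrite /B /= -mulgA mulVg mulg1.
apply: contrapT => nB.
have [||z [nBt [t _ tE]]] := @gc_dense G H (~` B).
- by exists (x * a^-1)%g.
- exact: closed_openC.
by apply: nBt; rewrite -tE; apply: (invA t); exists a.
Qed.

Section rotation_on_characters.
Context (R : realType) (G : topologicalGroupType) (sigma : set (G -> Cplx R)).
Context (sigma_subgroup : dual_subgroup sigma).

Let K := rotation (char_compactification sigma).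

Let sigma_dual chi : sigma chi -> dual_group chi.
Proof. by case: sigma_subgroup => sd _ _ _; exact: sd. Qed.

Definition coordinate chi (schi : sigma chi) : K -> Cplx R :=
  fun x => hull_val (x : char_hull sigma)
             (exist _ chi (mem_set (conj schi (sigma_dual schi)))).

Lemma coordinate_eigenfunction chi (schi : sigma chi) :
  eigenfunction chi (coordinate schi).
Proof.
split; first exact: hull_val_continuous.
move=> t; apply/funext => x; rewrite /koopman /coordinate.
by rewrite [LHS]hull_val_mul [gc_map _ _]/(hull_point _ _) hull_val_point invgK.
Qed.

(** Two points with the same coordinates are equal by construction. *)
Lemma coordinates_dense (f : K -> Cplx R) (e : R) : continuous f -> 0 < e ->
  exists2 g, trig_poly K sigma g & forall x, `|f x - g x| < toC e.
Proof.
apply: separating_trig_poly_dense => // x y xy; apply: contrapT => nsep.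
move/eqP: xy; apply; apply: hull_eqP => chi.
have [schi chiD] := set_valP chi.
apply: contrapT => xchi; apply: nsep; exists (set_val chi), (coordinate schi).
split=> //; first exact: coordinate_eigenfunction.
apply/eqP => xy; apply: xchi; move: xy; rewrite /coordinate.
by rewrite (_ : exist _ _ _ = chi) //; apply: val_inj.
Qed.

Lemma rotation_discrete_spectrum : discrete_spectrum R K.
Proof. exact: dense_discrete_spectrum coordinates_dense. Qed.

(** If eta were in the spectrum but not in sigma, an eigenfunction f for eta would
    be approximated within |f(1)| / 2 by a sum of eigenfunctions for characters
    in sigma. Along the orbit of 1 this is an approximation of f(1) * eta by a
    combination of characters other than eta, so |f(1)| <= |f(1)| / 2. *)
Lemma rotation_point_spectrum : point_spectrum R K = sigma.
Proof.
apply/seteqP; split=> [eta [etaD [f [fc f0 fE]]]|chi schi]; last first.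
  split; first exact: sigma_dual.
  have [cc cE] := coordinate_eigenfunction schi.
  exists (coordinate schi); split=> // c0.
  have := hull_norm (hull_point sigma 1%g)
    (exist _ chi (mem_set (conj schi (sigma_dual schi)))).
  have := congr1 (@^~ (hull_point sigma 1%g : K)) c0; rewrite /coordinate => ->.
  by rewrite normr0 => /eqP; rewrite eq_sym oner_eq0.
apply: contrapT => neta.
have ef : eigenfunction eta f by [].
pose o : K := hull_point sigma 1%g.
have fo0 : f o != 0.
  apply/eqP => fo0; apply: f0; apply/funext => x; apply/eqP.
  rewrite -normr_eq0.
  by rewrite (eigenfunction_modulus (@rotation_minimal _ _) x o etaD ef) fo0 normr0.
have [c cE c0] := toC_norm (f o).
have c1 : 0 < c by rewrite -toC_lt -cE normr_gt0.
have [|g gp fg] := @coordinates_dense f (c / 2) fc; first by rewrite divr_gt0.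
have [n [chi [h [schi eh gE]]]] := trig_polyE gp.
have : `|f o| <= toC (c / 2).
  apply: (@character_coefficient_bound _ _ _ chi eta (fun i => h i o)) => //.
  - by move=> i; exact: sigma_dual.
  - by move=> i chiE; apply: neta; rewrite -chiE.
  move=> s; have /ltW := fg (tds_act s^-1%g o); rewrite gE.
  rewrite (eigenfunction_act _ _ ef) invgK mulrC.
  congr (`|_ - _| <= _); apply: eq_bigr => i _.
  by rewrite (eigenfunction_act _ _ (eh i)) invgK mulrC.
by rewrite cE toC_le leNgt ltr_pdivrMr // mulrDr mulr1 ltrDr c1.
Qed.

End rotation_on_characters.

Theorem theorem4p4 (R : realType) (G : topologicalGroupType)
    (G_commutative : forall s t : G, (s * t)%g = (t * s)%g) :
  [/\ (forall S1 S2 : tds G,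
         minimal S1 -> discrete_spectrum R S1 ->
         minimal S2 -> discrete_spectrum R S2 ->
         tds_isomorphic S1 S2 <-> point_spectrum R S1 = point_spectrum R S2),
      (forall sigma : set (G -> Cplx R), dual_subgroup sigma ->
         exists S : tds G,
           [/\ minimal S, discrete_spectrum R S & point_spectrum R S = sigma]) &
      (forall S : tds G, minimal S -> discrete_spectrum R S ->
         exists H : group_compactification G, tds_isomorphic S (rotation H))].
Proof.
split.
- move=> S1 S2 m1 d1 m2 d2; split=> [iso|specE].
    apply/seteqP; split; first exact: isomorphic_point_spectrum_sub.
    exact/isomorphic_point_spectrum_sub/tds_isomorphic_sym.
  apply: tds_isomorphic_trans (minimal_isomorphic_rotation m1 G_commutative d1) _.
  rewrite specE; apply: tds_isomorphic_sym.
  exact: minimal_isomorphic_rotation m2 G_commutative d2.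
- move=> sigma sgrp; exists (rotation (char_compactification sigma)); split.
  + exact: rotation_minimal.
  + exact: rotation_discrete_spectrum.
  + exact: rotation_point_spectrum.
- move=> S m d; exists (char_compactification (point_spectrum R S)).
  exact: minimal_isomorphic_rotation m G_commutative d.
Qed.
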